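(* Let $(\mathfrak{M}, \rho, \mathbb{Z}, \Xi)$ be a W*-dynamical system with $\mathcal{L}^2(\mathfrak{M}, \rho)$ separable, and let $(\mathfrak{A}, \mathbb{Z}, \Theta; \iota)$ be a faithful C*-model of $(\mathfrak{M}, \rho, \mathbb{Z}, \Xi)$ with $\mathfrak{A}$ separable and unital. Consider the following conditions. (i) The C*-dynamical system $(\mathfrak{A}, \mathbb{Z}, \Theta)$ is uniquely ergodic. (ii) The C*-dynamical system $(\mathfrak{A}, \mathbb{Z}, \Theta)$ is strictly ergodic. (iii) $\Gamma(\iota(a)) = \rho(\iota(a))$ for all positive $a \in \mathfrak{A}$. Then (i)$\iff$(ii) and (i)$\Rightarrow$(iii). Further, if $\mathcal{S}^{\mathbb{Z}}$ is a simplex, then (iii)$\Rightarrow$(i).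
   Context: A C*-dynamical system $(\mathfrak{A}, \mathbb{Z}, \Theta)$ consists of a unital C*-algebra $\mathfrak{A}$ and a group homomorphism $\Theta : \mathbb{Z} \to \operatorname{Aut}(\mathfrak{A})$ into the *-automorphisms of $\mathfrak{A}$. $\mathcal{S}^{\mathbb{Z}}$ is the set of $\Theta$-invariant states on $\mathfrak{A}$ (states $\phi$ with $\phi \circ \Theta_j = \phi$ for all $j$), with the weak*-topology. The system is uniquely ergodic if $\mathcal{S}^{\mathbb{Z}}$ is a singleton, and strictly ergodic if it is uniquely ergodic and its unique invariant state is faithful. A W*-dynamical system $(\mathfrak{M}, \rho, \mathbb{Z}, \Xi)$ consists of a von Neumann algebra $\mathfrak{M}$, a faithful normal tracial state $\rho$ on $\mathfrak{M}$, and an action $\Xi$ of $\mathbb{Z}$ on $\mathfrak{M}$ by *-automorphisms with $\rho \circ \Xi_j = \rho$ for all $j$. $\mathcal{L}^2(\mathfrak{M}, \rho)$ is the Hilbert space completion of $\mathfrak{M}$ for the inner product $\langle x, y \rangle_\rho = \rho(y^* x)$. A C*-model of $(\mathfrak{M}, \rho, \mathbb{Z}, \Xi)$ is a quadruple $(\mathfrak{A}, \mathbb{Z}, \Theta; \iota)$ where $(\mathfrak{A}, \mathbb{Z}, \Theta)$ is a C*-dynamical system and $\iota : \mathfrak{A} \to \mathfrak{M}$ is a *-homomorphism such that (a) $\iota(\mathfrak{A})$ is dense in $\mathfrak{M}$ in the weak operator topology, (b) $\Xi_j(\iota(\mathfrak{A})) = \iota(\mathfrak{A})$ for all $j \in \mathbb{Z}$,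 (c) $\Xi_j \circ \iota = \iota \circ \Theta_j$ for all $j \in \mathbb{Z}$. It is faithful if $\iota$ is injective. The gauge of a positive element $b \in \mathfrak{M}$ is $\Gamma(b) := \lim_{k \to \infty} \frac{1}{k} \left\| \sum_{j=0}^{k-1} \Xi_j b \right\|$; the limit exists by subadditivity. A compact convex subset $K$ of a locally convex real topological vector space, contained in a hyperplane not containing the origin, is a simplex if, with $P = \{ck : c \in \mathbb{R}_{\geq 0}, k \in K\}$, the relation $a \leq b \iff b - a \in P$ is a lattice ordering on $P - P$. Here the ambient space is the space of bounded self-adjoint linear functionals on $\mathfrak{A}$ with the weak*-topology. *)

(* Defs.v *)
From HB Require Import structures.
From mathcomp Require Import all_boot all_order all_algebra.
From mathcomp Require Import all_classical all_reals all_analysis.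
From mathcomp Require Import complex ring.
Set Implicit Arguments.
Unset Strict Implicit.
Unset Printing Implicit Defensive.
Import Order.TTheory GRing.Theory Num.Theory.
Import numFieldNormedType.Exports.
Local Open Scope classical_set_scope.
Local Open Scope ring_scope.

Definition separable (T : topologicalType) : Prop :=
  exists2 D : set T, countable D & dense D.

(* The scalars are R[i], so the norm `|x| is a nonnegative real element of
   R[i], and 0 <= z in R[i] says that z is real and nonnegative. *)

(* GRing.PzSemiRing and the norm structures have no join in the hierarchy below
   Num.NumDomain, so a structure cannot inherit from both normedModType and
   algType: the product is a field here, and the algType instance on the
   carrier is derived. *)
HB.mixin Record isCStar (R : realType) A & CompleteNormedModule R[i] A := {
  cstar_one : A ;
  cstar_mul : A -> A -> A ;
  star : A -> A ;
  cstar_mulA : associative cstar_mul ;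
  cstar_mul1l : left_id cstar_one cstar_mul ;
  cstar_mul1r : right_id cstar_one cstar_mul ;
  cstar_mulDl : left_distributive cstar_mul +%R ;
  cstar_mulDr : right_distributive cstar_mul +%R ;
  cstar_one_neq0 : cstar_one != 0 ;
  cstar_scaleAl : forall (k : R[i]) x y,
    k *: cstar_mul x y = cstar_mul (k *: x) y ;
  cstar_scaleAr : forall (k : R[i]) x y,
    k *: cstar_mul x y = cstar_mul x (k *: y) ;
  starD : {morph star : x y / x + y} ;
  starZ : forall (k : R[i]) x, star (k *: x) = k^* *: star x ;
  starM : forall x y, star (cstar_mul x y) = cstar_mul (star y) (star x) ;
  starK : involutive star ;
  cstar_normM : forall x y, `|cstar_mul x y| <= `|x| * `|y| ;
  cstar_norm : forall x, `|cstar_mul (star x) x| = `|x| ^+ 2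
}.

#[short(type="cstarAlgType")]
HB.structure Definition CStarAlgebra (R : realType) :=
  {A of CompleteNormedModule R[i] A & isCStar R A}.

#[non_forgetful_inheritance]
HB.instance Definition _ (R : realType) (A : cstarAlgType R) :=
  GRing.Zmodule_isNzRing.Build (CStarAlgebra.sort A) cstar_mulA cstar_mul1l
    cstar_mul1r cstar_mulDl cstar_mulDr cstar_one_neq0.
#[non_forgetful_inheritance]
HB.instance Definition _ (R : realType) (A : cstarAlgType R) :=
  GRing.Lmodule_isLalgebra.Build R[i] (CStarAlgebra.sort A) cstar_scaleAl.
#[non_forgetful_inheritance]
HB.instance Definition _ (R : realType) (A : cstarAlgType R) :=
  GRing.Lalgebra_isAlgebra.Build R[i] (CStarAlgebra.sort A) cstar_scaleAr.

HB.mixin Record isHilbert (R : realType) H & CompleteNormedModule R[i] H := {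
  inner : H -> H -> R[i] ;
  inner_linearl : forall y, scalar (inner^~ y) ;
  inner_conj : forall x y, inner y x = (inner x y)^* ;
  inner_norm : forall x, inner x x = `|x| ^+ 2
}.

#[short(type="hilbertType")]
HB.structure Definition Hilbert (R : realType) :=
  {H of CompleteNormedModule R[i] H & isHilbert R H}.

Section star_algebra.
Context (R : realType).

Definition self_adjoint (A : cstarAlgType R) (a : A) : Prop := star a = a.

Definition positive (A : cstarAlgType R) (a : A) : Prop :=
  exists b, a = star b * b.

Definition star_hom (A B : cstarAlgType R) (f : A -> B) : Prop :=
  [/\ linear f, {morph f : x y / x * y} & {morph f : x / star x}].

Definition star_automorphism (A : cstarAlgType R) (f : A -> A) : Prop :=
  star_hom f /\ bijective f.

Definition is_Z_action (A : cstarAlgType R) (Theta : int -> A -> A) : Prop :=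
  (forall j, star_automorphism (Theta j)) /\
  (forall i j, Theta (i + j) = Theta i \o Theta j).

End star_algebra.

(* The real vector space of bounded self-adjoint functionals, with the
   weak* topology. *)
Section sa_dual_def.
Context (R : realType) (A : cstarAlgType R).

Definition sa_functional (f : A -> R[i]) : Prop :=
  [/\ scalar f,
      exists c : R[i], forall a, `|f a| <= c * `|a|
    & forall a, f (star a) = (f a)^*].

Record sa_dual := SaDual {
  sa_fun :> A -> R[i] ;
  sa_funP : `[< sa_functional sa_fun >]
}.

HB.instance Definition _ := [isSub for sa_fun].
HB.instance Definition _ := [Choice of sa_dual by <:].

End sa_dual_def.

Section sa_dual_lmod.
Context (R : realType) (A : cstarAlgType R).
Local Notation D := (sa_dual A).
Implicit Types (f g : D) (r : R).

Lemma sa_dualP f : sa_functional f.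
Proof. exact/asboolP/sa_funP. Qed.

Lemma sa_dual_eq f g : f =1 g -> f = g.
Proof. by move=> fg; apply/val_inj/funext. Qed.

Fact sa0_subproof : sa_functional (fun _ : A => 0 : R[i]).
Proof.
split=> [k x y|| a] /=; rewrite ?conjC0 ?mulr0 ?addr0//.
by exists 0 => a; rewrite normr0 mul0r.
Qed.

Fact saN_subproof f : sa_functional (fun a => - f a).
Proof.
have [fl [c fc] fs] := sa_dualP f; split=> [k x y||a].
- by rewrite fl opprD mulrN.
- by exists c => a; rewrite normrN.
- by rewrite fs rmorphN.
Qed.

Fact saD_subproof f g : sa_functional (fun a => f a + g a).
Proof.
have [fl [c fc] fs] := sa_dualP f; have [gl [d gd] gs] := sa_dualP g.
split=> [k x y||a].
- by rewrite fl gl mulrDr addrACA.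
- exists (c + d) => a.
  by rewrite mulrDl (le_trans (ler_normD _ _))// lerD.
- by rewrite fs gs rmorphD.
Qed.

Fact saZ_subproof r f : sa_functional (fun a => r%:C%C * f a).
Proof.
have [fl [c fc] fs] := sa_dualP f; split=> [k x y||a].
- by rewrite fl mulrDr mulrCA.
- exists (`|r%:C%C| * c) => a.
  by rewrite normrM -mulrA ler_wpM2l.
- rewrite fs rmorphM/=; congr (_ * _).
  by apply/esym/CrealP/complex_realP; exists r.
Qed.

Definition sa0 : D := SaDual (asboolT sa0_subproof).
Definition saN f : D := SaDual (asboolT (saN_subproof f)).
Definition saD f g : D := SaDual (asboolT (saD_subproof f g)).
Definition saZ r f : D := SaDual (asboolT (saZ_subproof r f)).

Fact saDA : associative saD.
Proof. by move=> f g h; apply: sa_dual_eq => a /=; rewrite addrA. Qed.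
Fact saDC : commutative saD.
Proof. by move=> f g; apply: sa_dual_eq => a /=; rewrite addrC. Qed.
Fact sa0D : left_id sa0 saD.
Proof. by move=> f; apply: sa_dual_eq => a /=; rewrite add0r. Qed.
Fact saND : left_inverse sa0 saN saD.
Proof. by move=> f; apply: sa_dual_eq => a /=; rewrite addNr. Qed.

HB.instance Definition _ := GRing.isZmodule.Build D saDA saDC sa0D saND.

Fact saZA r s f : saZ r (saZ s f) = saZ (r * s) f.
Proof. by apply: sa_dual_eq => a /=; rewrite mulrA rmorphM. Qed.
Fact saZ1 : left_id 1 saZ.
Proof. by move=> f; apply: sa_dual_eq => a /=; rewrite rmorph1 mul1r. Qed.
Fact saZDr : right_distributive saZ +%R.
Proof. by move=> r f g; apply: sa_dual_eq => a /=; rewrite mulrDr. Qed.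
Fact saZDl f : {morph saZ^~ f : r s / r + s}.
Proof. by move=> r s; apply: sa_dual_eq => a /=; rewrite rmorphD mulrDl. Qed.

HB.instance Definition _ :=
  GRing.Zmodule_isLmodule.Build R D saZA saZ1 saZDr saZDl.

Definition sa_eval (f : D) : {ptws A -> R[i]^o} := f.

HB.instance Definition _ := Uniform.copy D (initial_topology sa_eval).

End sa_dual_lmod.

Section sa_dual_tvs.
Context (R : realType) (A : cstarAlgType R).
Local Notation D := (sa_dual A).
Implicit Types (f g : D).

Lemma cvg_initial (S : choiceType) (T : topologicalType) (h : S -> T)
    (F : set_system S) (s : S) : Filter F ->
  h @ F --> h s -> F --> (s : initial_topology h).
Proof.
move=> FF hF U; rewrite nbhsE => -[_ [[C oC <-] Cs] CU].
by apply: filterS CU _; apply: hF; exact: open_nbhs_nbhs.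
Qed.

Lemma sa_dual_cvg (F : set_system D) f : Filter F ->
  (forall a, (fun g : D => g a : R[i]^o) @ F --> (f a : R[i]^o)) -> F --> f.
Proof.
move=> FF Ff; apply: cvg_initial; apply/cvg_sup => a.
by apply: cvg_initial; exact: Ff.
Qed.

Lemma sa_dual_eval_continuous a : continuous (fun g : D => g a : R[i]^o).
Proof.
pose ev (h : {ptws A -> R[i]^o}) : R[i]^o := h a.
have ev_cont : continuous ev.
  move=> h.
  have [/(_ (fun _ => id) a) hh _] := @cvg_sup _ _ (fun a => Topological.class
    (initial_topology (fun h : A -> R[i]^o => h a))) (nbhs h) h (@nbhs_filter _ h).
  by apply: cvg_trans (@initial_continuous _ _ ev h); apply: cvg_app; exact: hh.
move=> f; apply: (@continuous_comp D _ _ (@sa_eval R A) ev) => //.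
  exact: initial_continuous.
exact: ev_cont.
Qed.

Fact sa_dual_add_continuous : continuous (fun x : D * D => x.1 + x.2).
Proof.
move=> [f g]; apply: sa_dual_cvg => a.
have fa : (fun x : D * D => x.1 a : R[i]^o) @ nbhs (f, g) --> (f a : R[i]^o).
  apply: (@cvg_comp _ _ _ fst (fun h : D => h a : R[i]^o)) (cvg_fst) _.
  exact: sa_dual_eval_continuous.
have ga : (fun x : D * D => x.2 a : R[i]^o) @ nbhs (f, g) --> (g a : R[i]^o).
  apply: (@cvg_comp _ _ _ snd (fun h : D => h a : R[i]^o)) (cvg_snd) _.
  exact: sa_dual_eval_continuous.
exact: cvgD fa ga.
Qed.

Lemma normc_real (x : R) : `|x%:C%C| = `|x|%:C%C.
Proof. by rewrite normc_def/= expr0n addr0 sqrtr_sqr. Qed.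

Lemma real_complex_continuous : continuous (fun r : R^o => r%:C%C : R[i]^o).
Proof.
move=> r; apply/(@cvgrPdist_lt _ R[i]^o) => e e0.
have /complex_realP[d de] := gtr0_real e0; move: e0; rewrite de => d0.
have {}d0 : 0 < d by rewrite -ltcR.
near=> s; rewrite -rmorphB normc_real ltcR; near: s.
exact: (@cvgr_dist_lt _ R^o).
Unshelve. all: by end_near. Qed.

Fact sa_dual_scale_continuous :
  continuous (fun x : R^o * D => x.1 *: x.2).
Proof.
move=> [r f]; apply: sa_dual_cvg => a.
have rr : (fun x : R^o * D => x.1%:C%C : R[i]^o) @ nbhs (r : R^o, f)
    --> (r%:C%C : R[i]^o).
  apply: (@cvg_comp _ _ _ fst (fun t : R^o => t%:C%C : R[i]^o)) (cvg_fst) _.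
  exact: real_complex_continuous.
have fa : (fun x : R^o * D => x.2 a : R[i]^o) @ nbhs (r : R^o, f)
    --> (f a : R[i]^o).
  apply: (@cvg_comp _ _ _ snd (fun h : D => h a : R[i]^o)) (cvg_snd) _.
  exact: sa_dual_eval_continuous.
exact: (@cvgZ _ R[i]^o _ _ _ _ _ _ _ rr fa).
Qed.

Fact sa_dual_locally_convex :
  exists2 B : set_system D, (forall b, b \in B -> convex_set b) & basis B.
Proof.
exists [set U | open U /\ convex_set U].
  by move=> b; rewrite inE => -[].
split=> [U []//|f].
have FF : Filter (filter_from [set U : set D | (open U /\ convex_set U) /\ U f] id).
  apply: filter_from_filter.
    exists setT; split=> //; split; first exact: openT.
    by move=> ? ? ?; rewrite !inE.
  move=> U V [[oU cU] Uf] [[oV cV] Vf]; exists (U `&` V) => //.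
  split=> //; split; first exact: openI.
  move=> x y l; rewrite !inE => -[Ux Vx] [Uy Vy].
  split; apply/set_mem; [apply: cU|apply: cV]; exact/mem_set.
apply: sa_dual_cvg => a.
apply/(@cvgrPdist_lt _ R[i]^o) => e e0.
exists [set g : D | `|f a - g a| < e] => //; split=> /=; last first.
  by rewrite subrr normr0.
split.
  have := @ball_open _ R[i]^o (f a) e; rewrite -ball_normE.
  by apply: open_comp => g _; exact: sa_dual_eval_continuous.
apply/convex_setW => x y; rewrite !inE/= => xe ye l l0 l1; rewrite inE/=.
rewrite /unstable.onem; move: (l%:num) l0 l1 => t t0; rewrite -subr_gt0 => t1.
have tE : (1 - t)%:C%C = 1 - t%:C%C :> R[i] by rewrite rmorphB rmorph1.
have -> : f a - (t%:C%C * x a + (1 - t)%:C%C * y a) =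
    t%:C%C * (f a - x a) + (1 - t)%:C%C * (f a - y a).
  by rewrite tE; ring.
rewrite (le_lt_trans (ler_normD _ _))// !normrM !normc_real (gtr0_norm t0) (gtr0_norm t1).
have -> : e = t%:C%C * e + (1 - t)%:C%C * e by rewrite tE; ring.
by apply: ltrD; rewrite ltr_pM2l//; [move: t0|move: t1]; rewrite -ltcR.
Qed.

HB.instance Definition _ :=
  PreTopologicalNmodule_isTopologicalNmodule.Build D sa_dual_add_continuous.
HB.instance Definition _ :=
  TopologicalNmodule_isTopologicalLmodule.Build R D sa_dual_scale_continuous.
HB.instance Definition _ := Uniform_isTvs.Build R D sa_dual_locally_convex.

End sa_dual_tvs.

Definition is_lub_in (T : Type) (S : set T) (le : T -> T -> Prop) (D : set T)
    (x : T) : Prop :=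
  [/\ S x, forall d, D d -> le d x
    & forall u, S u -> (forall d, D d -> le d u) -> le x u].

Definition is_glb_in (T : Type) (S : set T) (le : T -> T -> Prop) (D : set T)
    (x : T) : Prop := is_lub_in S (fun a b => le b a) D x.

Section simplex.
Context (R : realType).

Definition lattice_ordering (T : Type) (S : set T) (le : T -> T -> Prop)
    : Prop :=
  [/\ forall a, S a -> le a a,
      forall a b, S a -> S b -> le a b -> le b a -> a = b,
      forall a b c, S a -> S b -> S c -> le a b -> le b c -> le a c
    & forall a b, S a -> S b ->
        (exists s, is_lub_in S le [set a; b] s) /\
        (exists m, is_glb_in S le [set a; b] m)].

Definition hyperplane (E : lmodType R) (X : set E) : Prop :=
  exists (f : {scalar E}) (c : R), (exists x, f x != 0) /\
    X = [set x | f x = c].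

Definition is_simplex (E : tvsType R) (K : set E) : Prop :=
  let P := [set x | exists c k, [/\ 0 <= c :> R, K k & x = c *: k]] in
  let PP := [set x | exists p q, [/\ P p, P q & x = p - q]] in
  [/\ compact K, convex_set K,
      exists X, [/\ hyperplane X, ~ X 0 & K `<=` X]
    & lattice_ordering PP (fun a b => P (b - a))].

End simplex.

Section states.
Context (R : realType) (A : cstarAlgType R).

Definition is_state (phi : sa_dual A) : Prop :=
  (forall a, positive a -> 0 <= phi a) /\ phi 1 = 1.

Definition faithful_state (phi : sa_dual A) : Prop :=
  forall a, phi (star a * a) = 0 -> a = 0.

Definition tracial_state (phi : sa_dual A) : Prop :=
  forall a b, phi (a * b) = phi (b * a).

Definition pos_le (a b : A) : Prop := positive (b - a).

(* Preservation of suprema of increasing nets of self-adjoint elements; the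
   range of such a net is an upward directed set, and conversely. *)
Definition normal_state (phi : sa_dual A) : Prop :=
  forall (D : set A) (x : A),
    D !=set0 -> D `<=` @self_adjoint R A ->
    (forall a b, D a -> D b -> exists c, [/\ D c, pos_le a c & pos_le b c]) ->
    is_lub_in (@self_adjoint R A) pos_le D x ->
    supremums (phi @` D) (phi x).

Definition invariant_states (Theta : int -> A -> A) : set (sa_dual A) :=
  [set phi | is_state phi /\ forall j a, phi (Theta j a) = phi a].

Definition uniquely_ergodic (Theta : int -> A -> A) : Prop :=
  exists phi, invariant_states Theta = [set phi].

Definition strictly_ergodic (Theta : int -> A -> A) : Prop :=
  exists phi, invariant_states Theta = [set phi] /\ faithful_state phi.

Definition gauge (Xi : int -> A -> A) (b : A) : R[i]^o :=
  limn (fun k : nat => k%:R^-1 * `|\sum_(0 <= j < k) Xi j%:Z b| : R[i]^o).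

End states.

Section bounded_operators.
Context (R : realType) (H : hilbertType R).

Record bounded_op := BoundedOp {
  op_fun :> H -> H ;
  op_linear : linear op_fun ;
  op_bounded : exists c : R[i], forall v, `|op_fun v| <= c * `|v|
}.

HB.instance Definition _ := gen_eqMixin bounded_op.
HB.instance Definition _ := gen_choiceMixin bounded_op.

Definition op_coef (T : bounded_op) : {ptws H * H -> R[i]^o} :=
  fun vw => inner (T vw.1) vw.2.

(* B(H) with the weak operator topology *)
Definition wot : topologicalType := initial_topology op_coef.

End bounded_operators.

(* A von Neumann algebra on H is a unital *-subalgebra of B(H) closed in the
   weak operator topology. It is given here as a C*-algebra M together with
   the inclusion of M in B(H): the operations and the norm of M are those of
   B(H). *)
Record von_neumann_algebra (R : realType) (H : hilbertType R)
    (M : cstarAlgType R) (incl : M -> bounded_op H) : Prop := {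
  vn_linear : forall v, linear (fun x => incl x v) ;
  vn_mul : forall x y v, incl (x * y) v = incl x (incl y v) ;
  vn_one : forall v, incl 1 v = v ;
  vn_star : forall x v w, inner (incl (star x) v) w = inner v (incl x w) ;
  vn_norm_le : forall x v, `|incl x v| <= `|x| * `|v| ;
  vn_norm_min : forall x (c : R[i]), 0 <= c ->
    (forall v, `|incl x v| <= c * `|v|) -> `|x| <= c ;
  vn_closed : closed (range incl : set (wot H))
}.

Record wstar_system (R : realType) (H : hilbertType R) (M : cstarAlgType R)
    (incl : M -> bounded_op H) (rho : sa_dual M) (Xi : int -> M -> M)
    : Prop := {
  ws_algebra : von_neumann_algebra incl ;
  ws_state : is_state rho ;
  ws_faithful : faithful_state rho ;
  ws_normal : normal_state rho ;
  ws_tracial : tracial_state rho ;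
  ws_action : is_Z_action Xi ;
  ws_invariant : forall j x, rho (Xi j x) = rho x
}.

(* L, with the canonical map Lambda, is the Hilbert space completion of M for
   the inner product rho (y^* x). *)
Definition L2_completion (R : realType) (M : cstarAlgType R)
    (rho : sa_dual M) (L : hilbertType R) (Lambda : M -> L) : Prop :=
  [/\ linear Lambda,
      forall x y, inner (Lambda x) (Lambda y) = rho (star y * x)
    & dense (range Lambda)].

Record cstar_model (R : realType) (H : hilbertType R) (M : cstarAlgType R)
    (incl : M -> bounded_op H) (Xi : int -> M -> M) (A : cstarAlgType R)
    (Theta : int -> A -> A) (iota : A -> M) : Prop := {
  cm_action : is_Z_action Theta ;
  cm_hom : star_hom iota ;
  cm_dense : range incl `<=` closure (range (incl \o iota) : set (wot H)) ;
  cm_stable : forall j, Xi j @` range iota = range iota ;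
  cm_equivariant : forall j, Xi j \o iota = iota \o Theta j
}.

(* Main.v *)
Require Import Defs.
From HB Require Import structures.
From mathcomp Require Import all_boot all_order all_algebra.
From mathcomp Require Import all_classical all_reals all_analysis.
From mathcomp Require Import complex ring lra.
Import Order.TTheory GRing.Theory Num.Theory.
Import numFieldNormedType.Exports.
Set Implicit Arguments.
Unset Strict Implicit.
Unset Printing Implicit Defensive.
Local Open Scope classical_set_scope.
Local Open Scope ring_scope.

(* The restriction rho \o iota is a faithful invariant state, which gives
   (i) <-> (ii). Any invariant state phi satisfies
   phi a <= k^-1 |Xi_0 (iota a) + ... + Xi_(k-1) (iota a)|, since an injective
   *-homomorphism reflects positivity; hence phi <= gauge \o iota on positive
   elements. Under (iii) this reads phi <= rho \o iota, and applying it to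
   |a| 1 - a as well gives equality. Conversely, if the averages exceed
   rho (iota a) + e infinitely often, unit vectors nearly attaining their norms
   give averaged vector states, and a weak* cluster point of these is an
   invariant state other than rho \o iota. Positivity is handled without
   spectral theory, through the square root of 1 - x for |x| <= 1. *)

(** * Involution and norm in a C*-algebra *)

Section cstar_basics.
Context (R : realType) (A : cstarAlgType R).
Implicit Types (x y : A) (k : R[i]).

Lemma star_additive : {morph @star R A : x y / x - y}.
Proof. by move=> x y; rewrite starD -scaleN1r starZ rmorphN rmorph1 scaleN1r. Qed.

(** [star] is only conjugate-linear; recording its additivity makes the [raddf] lemmas apply to
    it. *)
HB.instance Definition _ :=
  GRing.isZmodMorphism.Build A A (@star R A) star_additive.

Lemma star_mul x y : star (x * y) = star y * star x.
Proof. exact: starM. Qed.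

Lemma star1 : star (1 : A) = 1.
Proof.
by have := star_mul 1 (star 1 : A); rewrite starK mul1r starK => <-.
Qed.

Lemma normM_le x y : `|x * y| <= `|x| * `|y|.
Proof. exact: cstar_normM. Qed.

Lemma norm_starM x : `|star x * x| = `|x| ^+ 2.
Proof. exact: cstar_norm. Qed.

(** The C*-identity gives [|y|^2 <= |star y| |y|], hence [|y| <= |star y|] for every [y]; the case
    [y = star x] is the reverse inequality. *)
Lemma norm_star x : `|star x| = `|x|.
Proof.
have le y : `|y| <= `|star y|.
  have [->|y0] := eqVneq y 0; first by rewrite normr0.
  have := normM_le (star y) y.
  by rewrite norm_starM expr2 ler_pM2r// normr_gt0.
by apply/eqP; rewrite eq_le le andbT -{2}(starK x) le.
Qed.

Lemma norm_one : `|1 : A| = 1.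
Proof.
have := norm_starM 1; rewrite star1 mulr1 expr2 -{1}[`|1 : A|]mulr1.
by move/mulfI => <-//; rewrite normr_eq0 oner_neq0.
Qed.

Lemma norm_sa_sqr x : self_adjoint x -> `|x * x| = `|x| ^+ 2.
Proof. by move=> xs; rewrite -norm_starM xs. Qed.

Lemma commZ k (x y : A) : x * y = y * x -> x * (k *: y) = (k *: y) * x.
Proof. by move=> h; rewrite -scalerAr -scalerAl h. Qed.

End cstar_basics.

(** * Square root of [1 - x] by successive approximation *)

Section cstar_sqrt.
Context (R : realType) (A : cstarAlgType R).
Implicit Types (x y z : A).

(* sqrt_maj, the iteration for x = 1, majorises sqrt_iter x when |x| <= 1. *)
Fixpoint sqrt_maj (n : nat) : R :=
  if n is m.+1 then 2^-1 * (1 + sqrt_maj m ^+ 2) else 0.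

Fixpoint sqrt_iter x (n : nat) : A :=
  if n is m.+1 then 2^-1 *: (x + sqrt_iter x m * sqrt_iter x m) else 0.

Lemma sqrt_maj_itv n : 0 <= sqrt_maj n <= 1.
Proof. by elim: n => [|n /andP[h0 h1]] /=; nra. Qed.

Lemma sqrt_maj_le n : sqrt_maj n <= sqrt_maj n.+1.
Proof.
rewrite -subr_ge0 (_ : _ - _ = 2^-1 * (1 - sqrt_maj n) ^+ 2) /=; last by field.
by rewrite mulr_ge0 ?sqr_ge0// invr_ge0.
Qed.

Lemma sqrt_maj_cvg : cvgn sqrt_maj.
Proof.
apply: nondecreasing_is_cvgn; first exact/nondecreasing_seqP/sqrt_maj_le.
by exists 1 => _ [n _ <-]; case/andP: (sqrt_maj_itv n).
Qed.

Lemma sqrt_iter_comm z x n : z * x = x * z -> z * sqrt_iter x n = sqrt_iter x n * z.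
Proof.
move=> zx; elim: n => [|n ih] /=; first by rewrite mulr0 mul0r.
by apply: commZ; rewrite mulrDr mulrDl zx mulrA ih -!mulrA ih.
Qed.

Lemma sqrt_iter_sa x n : self_adjoint x -> self_adjoint (sqrt_iter x n).
Proof.
move=> xs; elim: n => [|n ih] /=; first exact: raddf0.
rewrite /self_adjoint starZ starD star_mul ih xs.
by rewrite fmorphV rmorph_nat.
Qed.

Lemma sqrt_iter_norm x n : `|x| <= 1 -> `|sqrt_iter x n| <= (sqrt_maj n)%:C%C.
Proof.
move=> x1; elim: n => [|n ih] /=; first by rewrite normr0.
rewrite normrZ rmorphM/= fmorphV rmorph_nat rmorphD rmorph1 rmorphXn/=.
rewrite ger0_norm ?invr_ge0 ?ler0n// ler_pM2l ?invr_gt0 ?ltr0n//.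
apply: (le_trans (ler_normD _ _)); apply: lerD => //.
apply: (le_trans (normM_le _ _)); rewrite expr2.
exact: ler_pM.
Qed.

(** As the iterates commute, each increment is half the previous increment times the sum of the two
    iterates involved. The same recursion holds for [sqrt_maj], so the bound propagates by
    induction. *)
Lemma sqrt_iter_step x n : `|x| <= 1 ->
  `|sqrt_iter x n.+1 - sqrt_iter x n| <= (sqrt_maj n.+1 - sqrt_maj n)%:C%C.
Proof.
move=> x1; elim: n => [|n ih].
  rewrite /= !subr0 mulr0 addr0 expr0n/= addr0 mulr1 normrZ.
  rewrite ger0_norm ?invr_ge0 ?ler0n// fmorphV rmorph_nat.
  by rewrite ler_piMr// invr_ge0 ler0n.
set y := sqrt_iter x; set t := sqrt_maj.
have comm : y n * y n.+1 = y n.+1 * y n.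
  by apply: sqrt_iter_comm; apply/esym/sqrt_iter_comm.
have -> : y n.+2 - y n.+1 = 2^-1 *: ((y n.+1 - y n) * (y n.+1 + y n)).
  have yS m : y m.+1 = 2^-1 *: (x + y m * y m) by [].
  rewrite [y n.+2]yS [X in _ - X = _]yS -scalerBr opprD addrACA subrr add0r.
  by rewrite mulrBl !mulrDr comm addrKA.
have -> : t n.+2 - t n.+1 = 2^-1 * ((t n.+1 - t n) * (t n.+1 + t n)).
  by rewrite /t/=; field.
rewrite normrZ rmorphM/= fmorphV rmorph_nat.
rewrite ger0_norm ?invr_ge0 ?ler0n// ler_pM2l ?invr_gt0 ?ltr0n//.
apply: (le_trans (normM_le _ _)); rewrite rmorphM/=; apply: ler_pM => //.
by apply: (le_trans (ler_normD _ _)); rewrite rmorphD; apply: lerD; exact: sqrt_iter_norm.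
Qed.

Lemma sqrt_iter_cauchy x m n : `|x| <= 1 ->
  `|sqrt_iter x (n + m) - sqrt_iter x n| <= (sqrt_maj (n + m) - sqrt_maj n)%:C%C.
Proof.
move=> x1; elim: m => [|m ih]; first by rewrite addn0 !subrr normr0.
rewrite addnS -(subrKA (sqrt_iter x (n + m))) -(subrKA (sqrt_maj (n + m))) rmorphD/=.
by apply: (le_trans (ler_normD _ _)); apply: lerD => //; exact: sqrt_iter_step.
Qed.

(** The gaps of the convergent real sequence [sqrt_maj] dominate those of the iterates, which are
    therefore Cauchy in a complete space. *)
Lemma sqrt_iter_cvg x : `|x| <= 1 -> exists y : A,
  forall e : R, 0 < e -> exists N, forall n, (N <= n)%N ->
    `|y - sqrt_iter x n| <= e%:C%C.
Proof.
move=> x1; pose t := sqrt_maj; pose T := limn t.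
have tT n : t n <= T.
  apply: nondecreasing_cvgn_le; last exact: sqrt_maj_cvg.
  exact/nondecreasing_seqP/sqrt_maj_le.
have tc (e : R) : 0 < e -> exists N, forall n, (N <= n)%N -> T - t n < e.
  move=> e0; have /cvgrPdist_lt/(_ _ e0)[N _ h] := sqrt_maj_cvg.
  by exists N => n /h; rewrite ger0_norm// subr_ge0.
have yd n m : (n <= m)%N -> `|sqrt_iter x m - sqrt_iter x n| <= (T - t n)%:C%C.
  move=> /subnKC <-; apply: (le_trans (sqrt_iter_cauchy _ _ x1)).
  by rewrite lecR lerD2r.
have : cvg (sqrt_iter x n @[n --> \oo]).
  apply/cauchy_cvgP/cauchy_exP => e e0.
  have /complex_realP[d de] := gtr0_real e0; move: e0; rewrite de => d0.
  have {}d0 : 0 < d by rewrite -ltcR.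
  have [N hN] := tc _ d0; exists (sqrt_iter x N), N => // n /= Nn.
  rewrite -ball_normE/= distrC; apply: (le_lt_trans (yd _ _ Nn)).
  by rewrite ltcR hN.
move=> /cvg_ex[y /= yc]; exists y => e e0.
have e0' : 0 < e%:C%C by rewrite ltcR.
have /cvgrPdist_lt/(_ _ e0')[N _ h] := yc.
by exists N => n /h /ltW.
Qed.

(** Turns approximation by the iterates into exact identities for their limit. *)
Lemma norm_small_eq0 x (c : R[i]) :
  (forall e : R, 0 < e -> `|x| <= c * e%:C%C) -> x = 0.
Proof.
move=> h; have c0 : 0 <= c by have := h 1 ltr01; rewrite mulr1; exact: le_trans.
apply/eqP; rewrite -normr_eq0; apply/negPn/negP => x0.
have xp : 0 < `|x| by rewrite lt_neqAle eq_sym x0 /=.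
(* With this value for [e], [c * e] falls strictly below [|x|]. *)
have d0 : 0 < `|x| / (c + 1) / 2.
  by rewrite !divr_gt0// ltr_wpDl.
have /complex_realP[d de] := gtr0_real d0.
have := h d; rewrite -ltcR -de => /(_ d0).
move=> /le_lt_trans hx; suff /hx : c * (`|x| / (c + 1) / 2) < `|x| by rewrite ltxx.
rewrite mulrA ltr_pdivrMr// mulrCA ltr_pM2l//.
rewrite ltr_pdivrMr; last by rewrite ltr_wpDl.
rewrite mulrDr mulr1 (@lt_le_trans _ _ (c + 2))//; first by rewrite ltrDl.
by rewrite lerD2r ler_peMl// ler1n.
Qed.

(* The iterates converge to a root y of 2 y = x + y ^ 2, that is, of
   (1 - y) ^ 2 = 1 - x. *)
Lemma cstar_sqrt x : self_adjoint x -> `|x| <= 1 -> exists s : A,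
  [/\ self_adjoint s, s * s = 1 - x, `|1 - s| <= 1
    & forall z, z * x = x * z -> z * s = s * z].
Proof.
move=> xs x1; have [y hy] := sqrt_iter_cvg x1.
have y1 : `|y| <= 1.
  apply/ler_addgt0Pl => e e0.
  have /complex_realP[d de] := gtr0_real e0; move: e0; rewrite de => d0.
  have [|N /(_ N (leqnn _)) h] := hy d; first by rewrite -ltcR.
  rewrite -(subrK (sqrt_iter x N) y); apply: (le_trans (ler_normD _ _)).
  apply: lerD => //; apply: (le_trans (sqrt_iter_norm _ x1)).
  by rewrite lecR; case/andP: (sqrt_maj_itv N).
have ys : star y = y.
  apply/eqP; rewrite -subr_eq0; apply/eqP/(@norm_small_eq0 _ 2) => e e0.
  have [N /(_ N (leqnn _)) h] := hy _ e0.
  have -> : star y - y = star (y - sqrt_iter x N) - (y - sqrt_iter x N).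
    by rewrite raddfB/= (sqrt_iter_sa _ xs) opprB subrKA.
  apply: (le_trans (ler_normB _ _)); rewrite norm_star mulr_natl mulr2n.
  exact: lerD.
have yz z : z * x = x * z -> z * y = y * z.
  move=> zx; apply/eqP; rewrite -subr_eq0; apply/eqP.
  apply/(@norm_small_eq0 _ (2 * `|z|)) => e e0.
  have [N /(_ N (leqnn _)) h] := hy _ e0.
  have -> : z * y - y * z = z * (y - sqrt_iter x N) - (y - sqrt_iter x N) * z.
    by rewrite mulrBr mulrBl (sqrt_iter_comm _ zx) opprB subrKA.
  apply: (le_trans (ler_normB _ _)).
  rewrite -mulrA mulr_natl mulr2n; apply: lerD.
    by apply: (le_trans (normM_le _ _)); rewrite ler_wpM2l.
  by apply: (le_trans (normM_le _ _)); rewrite mulrC ler_wpM2l.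
(* For consecutive iterates [u], [v] one has [v + v = x + u * u], so the defect is
   [2 (y - v) - (y - u) (y + u)]. Each of the two terms is at most [2 e], whence the constant 4. *)
have y2 : y + y = x + y * y.
  apply/eqP; rewrite -subr_eq0; apply/eqP/(@norm_small_eq0 _ 4) => e e0.
  have [N h] := hy _ e0; have h0 := h _ (leqnn N); have h1 := h _ (leqnSn N).
  set u := sqrt_iter x N in h0; set v := sqrt_iter x N.+1 in h1.
  have vE : v + v = x + u * u.
    by rewrite -mulr2n -scaler_nat /v/= scalerA mulfV ?scale1r.
  have uy : u * y = y * u.
    apply/esym/sqrt_iter_comm; symmetry; apply: yz => //.
  have -> : y + y - (x + y * y) = 2 *: (y - v) - (y - u) * (y + u).
    have -> : (y - u) * (y + u) = y * y - u * u.
      by rewrite mulrBl !mulrDr uy addrKA.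
    rewrite scaler_nat mulr2n addrACA -opprD vE.
    by rewrite opprB -[RHS]addrA opprD [in RHS]opprD subrKA.
  apply: (le_trans (ler_normB _ _)).
  have -> : 4 * e%:C%C = 2 * e%:C%C + e%:C%C * 2 :> R[i] by ring.
  apply: lerD; first by rewrite normrZ ger0_norm// ler_pM2l.
  apply: (le_trans (normM_le _ _)); apply: ler_pM => //.
  apply: (le_trans (ler_normD _ _)); rewrite -[leRHS]/(1 + 1); apply: lerD => //.
  apply: (le_trans (sqrt_iter_norm _ x1)).
  by rewrite lecR; case/andP: (sqrt_maj_itv N).
exists (1 - y); split.
- by rewrite /self_adjoint raddfB/= star1 ys.
- rewrite mulrBr mulr1 mulrBl mul1r opprB -[LHS]addrA; congr (1 + _).
  by rewrite addrCA -opprD y2 opprD addrCA subrr addr0.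
- by rewrite opprB addrC subrK.
- by move=> z zx; rewrite mulrBr mulrBl mulr1 mul1r (yz _ zx).
Qed.

End cstar_sqrt.

(** * Positive elements and absolute values *)

Section positivity.
Context (R : realType) (A : cstarAlgType R).
Implicit Types (x y z : A).

(** [q] is a square root of the absolute value of [h], reached by three roots: [s] of [1 - h^2],
    then [k] of [1 - s^2 = h^2], then [q] of [1 - (1 - k) = k]. The last one is available because
    [cstar_sqrt] also bounds [|1 - k|]. *)
Lemma sa_abs h : self_adjoint h -> `|h : A| <= 1 -> exists q : A,
  [/\ self_adjoint q, h * q = q * h & q * q * (q * q) = h * h].
Proof.
move=> hs h1.
have hhs : self_adjoint (h * h) by rewrite /self_adjoint star_mul hs.
have hh1 : `|h * h| <= 1 by rewrite norm_sa_sqr// expr_le1.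
have [s [ss sE _ sC]] := cstar_sqrt hhs hh1.
have hsC : h * s = s * h by apply: sC; rewrite mulrA.
(* u is unitary, whence |s| <= 1. *)
pose u : A := h + 'i *: s.
have usE : star u = h - 'i *: s.
  by rewrite /u starD starZ hs ss conjCi scaleNr.
have uu : star u * u = 1.
  rewrite usE /u mulrBl !mulrDr -!scalerAl -!scalerAr hsC addrKA scalerA.
  by rewrite -['i * 'i]expr2 sqrCi scaleN1r opprK sE addrC subrK.
have u1 : `|u| = 1.
  apply/eqP; rewrite -(@pexpr_eq1 _ _ 2)//.
  by rewrite -norm_starM uu norm_one.
have s1 : `|s| <= 1.
  have : `|(2 * 'i) *: s| <= 2.
    have -> : (2 * 'i) *: s = u - star u.
      by rewrite usE /u opprB addrC addrA subrK -scalerA scaler_nat mulr2n.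
    by apply: (le_trans (ler_normB _ _)); rewrite norm_star u1.
  by rewrite normrZ normrM normCi mulr1 ger0_norm// ger_pMr.
have sss : self_adjoint (s * s) by rewrite /self_adjoint star_mul ss.
have ss1 : `|s * s| <= 1 by rewrite norm_sa_sqr// expr_le1.
have [k [ks kE k1 kC]] := cstar_sqrt sss ss1.
have hk : h * k = k * h by apply: kC; rewrite mulrA hsC -mulrA hsC mulrA.
have [|q [qs qE _ qC]] := @cstar_sqrt _ _ (1 - k) _ k1.
  by rewrite /self_adjoint raddfB/= star1 ks.
exists q; split => //.
- by apply: qC; rewrite mulrBr mulrBl mulr1 mul1r hk.
- by rewrite qE opprB addrC subrK kE sE opprB addrC subrK.
Qed.

Lemma sa_eq0 n : self_adjoint n -> n * n = 0 :> A -> n = 0.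
Proof.
move=> ns nn; apply/eqP; rewrite -normr_eq0 -sqrf_eq0 -norm_sa_sqr//.
by rewrite nn normr0.
Qed.

(* n is twice the negative part of h. *)
Lemma sa_neg_part h : self_adjoint h -> `|h : A| <= 1 -> exists q n : A,
  [/\ self_adjoint q, self_adjoint n, n * h * n = - (star (q * n) * (q * n))
    & q * n = 0 -> h = star q * q].
Proof.
move=> hs h1; have [q [qs hq qq]] := sa_abs hs h1.
pose n := q * q - h; exists q, n.
have hqq : h * (q * q) = q * q * h by rewrite mulrA hq -mulrA hq mulrA.
have ns : self_adjoint n by rewrite /self_adjoint raddfB/= star_mul qs hs.
have nq : n * q = q * n by rewrite mulrBl mulrBr hq mulrA.
have nh : n * h = - (n * (q * q)).
  by rewrite /n !mulrBl qq hqq opprB.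
split=> //.
  by rewrite nh star_mul ns qs mulNr !mulrA.
(* From [n h = - n q q] follows [n n = 2 n q q], which vanishes with [q n]; then [n = 0] and
   [h = q q]. *)
move=> qn; apply/esym/eqP; rewrite qs -subr_eq0; apply/eqP/sa_eq0 => //.
by rewrite -/n {2}/n mulrBr nh opprK mulrA nq qn mul0r addr0.
Qed.

Lemma positiveZ (c : R[i]) x : 0 <= c -> positive x -> positive (c *: x).
Proof.
move=> c0 [b ->]; exists (sqrtC c *: b).
rewrite starZ -scalerAl -scalerAr scalerA; congr (_ *: _).
rewrite (CrealP _) ?ger0_real ?sqrtC_ge0//.
by rewrite -expr2 sqrtCK.
Qed.

Lemma positive_sa x : positive x -> self_adjoint x.
Proof. by case=> b ->; rewrite /self_adjoint star_mul starK. Qed.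

(** After division by [|x|] this is [1 - y] with [|y| = 1], a square by [cstar_sqrt]. It is what
    bounds states by the norm. *)
Lemma norm_sub_positive x : self_adjoint x -> positive (`|x|%:A - x : A).
Proof.
move=> xs; have [->|x0] := eqVneq x 0.
  by rewrite normr0 scale0r subr0; exists 0; rewrite mulr0.
have n0 : `|x| != 0 by rewrite normr_eq0.
have [||s [ss sE _ _]] := @cstar_sqrt _ _ (`|x|^-1 *: x).
- by rewrite /self_adjoint starZ xs (CrealP _)// realV normr_real.
- by rewrite normrZ normfV normr_id mulVf.
have -> : `|x|%:A - x = `|x| *: (star s * s).
  by rewrite ss sE scalerBr scalerA mulfV// scale1r.
by apply: positiveZ => //; exists s.
Qed.

Lemma cartesian x : exists h k : A,
  [/\ self_adjoint h, self_adjoint k & x = h + 'i *: k].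
Proof.
exists (2^-1 *: (x + star x)), ((2 * 'i)^-1 *: (x - star x)).
have c2 : (2^-1 : R[i])^* = 2^-1 by rewrite fmorphV rmorph_nat.
split.
- by rewrite /self_adjoint starZ starD starK c2 addrC.
- rewrite /self_adjoint starZ raddfB/= starK fmorphV rmorphM rmorph_nat/= conjCi.
  by rewrite mulrN invrN scaleNr -scalerN opprB.
- rewrite scalerA invfM mulrCA mulfV ?neq0Ci// mulr1 -scalerDr addrACA.
  by rewrite subrr addr0 -mulr2n -(scaler_nat 2 x) scalerA mulVf// scale1r.
Qed.

(** Polarisation: [4 x = (x + 1)^2 - (x - 1)^2], so no decomposition into orthogonal parts is
    required. *)
Lemma sa_sub_sqr x : self_adjoint x -> exists y z : A,
  [/\ positive y, positive z & x = y - z].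
Proof.
move=> xs; exists (4^-1 *: (star (x + 1) * (x + 1))), (4^-1 *: (star (x - 1) * (x - 1))).
split; [by apply: positiveZ; [rewrite invr_ge0|exists (x + 1)]
       |by apply: positiveZ; [rewrite invr_ge0|exists (x - 1)]|].
rewrite starD raddfB/= star1 xs -scalerBr.
have -> : (x + 1) * (x + 1) - (x - 1) * (x - 1) = 4 *: x.
  rewrite [(x + 1) * _]mulrDr [(x - 1) * _]mulrBr !mulr1 opprB [x - 1 - _]addrC.
  rewrite addrACA -mulrBl opprB [1 - x]addrC addrACA subrr add0r.
  rewrite addrACA subrr addr0 mulrDl mul1r -!mulr2n -mulrnA.
  by rewrite scaler_nat.
by rewrite scalerA mulVf ?scale1r.
Qed.
End positivity.

(** * Cauchy-Schwarz for semi-definite forms *)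

Section positive_forms.
Context (R : realType) (V : lmodType R[i]) (B : V -> V -> R[i]).
Hypothesis B_linearl : forall y, scalar (B^~ y).
Hypothesis B_conj : forall x y, B y x = (B x y)^*.
Hypothesis B_ge0 : forall x, 0 <= B x x.

Lemma cauchy_schwarz x y : `|B x y| ^+ 2 <= B x x * B y y.
Proof.
have Bl k u v w : B (k *: u + v) w = k * B u w + B v w by rewrite B_linearl.
have Br k u v w : B w (k *: u + v) = k^* * B w u + B w v.
  by rewrite B_conj Bl rmorphD rmorphM/= -!B_conj.
(* This is nonnegativity of the form at [x - t b y], where [b = B x y]. *)
have quad (t : R[i]) : t \is Num.real ->
    0 <= B x x - 2 * t * `|B x y| ^+ 2 + t ^+ 2 * `|B x y| ^+ 2 * B y y.
  move=> tr; have := B_ge0 ((- (t * B x y)) *: y + x).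
  rewrite Bl !Br rmorphN rmorphM/= (CrealP tr) [B y x]B_conj normCK.
  by congr (0 <= _); ring.
have [y0|y0] := eqVneq (B y y) 0.
  rewrite y0 mulr0; have [->|b0] := eqVneq (B x y) 0; first by rewrite normr0 expr0n.
  have n0 : 0 < `|B x y| ^+ 2 by rewrite exprn_gt0// normr_gt0.
  have rx : B x x \is Num.real by exact: ger0_real.
  have tr : B x x / `|B x y| ^+ 2 \is Num.real by rewrite rpredM// rpredV ger0_real// ltW.
  (* When [B y y = 0] the expression is affine in [t], and this [t] makes it negative. *)
  have := quad ((B x x / `|B x y| ^+ 2) + 1).
  rewrite y0 mulr0 addr0 => /(_ (rpredD tr (rpred1 _))).
  have -> : B x x - 2 * (B x x / `|B x y| ^+ 2 + 1) * `|B x y| ^+ 2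
    = - (B x x + 2 * `|B x y| ^+ 2).
    by field; rewrite -[X in X != 0]/(`|B x y|) normr_eq0.
  rewrite oppr_ge0 => le0.
  have : 0 < B x x + 2 * `|B x y| ^+ 2 by rewrite ltr_wpDl// mulr_gt0.
  by move=> /(le_lt_trans le0); rewrite ltxx.
have yp : 0 < B y y by rewrite lt_neqAle eq_sym y0 B_ge0.
(* [t = 1 / B y y] minimises the quadratic. *)
have := quad (B y y)^-1; rewrite rpredV ger0_real// => /(_ isT).
rewrite -(pmulr_rge0 _ yp).
have -> : B y y * (B x x - 2 * (B y y)^-1 * `|B x y| ^+ 2 +
    (B y y)^-1 ^+ 2 * `|B x y| ^+ 2 * B y y) = B x x * B y y - `|B x y| ^+ 2.
  by field.
by rewrite subr_ge0.
Qed.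

End positive_forms.

(** * Inner products and norms of positive operators *)

Section hilbert.
Context (R : realType) (H : hilbertType R).
Implicit Types (v w : H).

Lemma inner0l w : inner 0 w = 0 :> R[i].
Proof. by have := inner_linearl w (-1) 0 0; rewrite scaler0 addr0 mulN1r addNr. Qed.

Lemma innerDl v1 v2 w : inner (v1 + v2) w = inner v1 w + inner v2 w :> R[i].
Proof. by have := inner_linearl w 1 v1 v2; rewrite scale1r mul1r. Qed.

Lemma innerZl k v w : inner (k *: v) w = k * inner v w :> R[i].
Proof. by have := inner_linearl w k v 0; rewrite !addr0 inner0l addr0. Qed.

Lemma innerZr k v w : inner v (k *: w) = k^* * inner v w :> R[i].
Proof. by rewrite inner_conj innerZl rmorphM/= -inner_conj. Qed.

Lemma innerBl v1 v2 w : inner (v1 - v2) w = inner v1 w - inner v2 w :> R[i].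
Proof. by rewrite innerDl -scaleN1r innerZl mulN1r. Qed.

Lemma innerBr w v1 v2 : inner w (v1 - v2) = inner w v1 - inner w v2 :> R[i].
Proof. by rewrite inner_conj innerBl rmorphB/= -!inner_conj. Qed.

Lemma inner_suml n (u : nat -> H) w :
  inner (\sum_(0 <= j < n) u j) w = \sum_(0 <= j < n) inner (u j) w :> R[i].
Proof.
elim: n => [|n ih]; first by rewrite !big_geq// inner0l.
by rewrite !big_nat_recr//= innerDl ih.
Qed.

Lemma inner_self_ge0 v : 0 <= inner v v :> R[i].
Proof. by rewrite inner_norm exprn_ge0. Qed.

Lemma norm_inner_le v w : `|inner v w| <= `|v| * `|w| :> R[i].
Proof.
rewrite -(@ler_pXn2r _ 2)// ?nnegrE ?mulr_ge0//.
rewrite exprMn -!inner_norm; apply: cauchy_schwarz.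
- by move=> y; exact: inner_linearl.
- by move=> *; exact: inner_conj.
- exact: inner_self_ge0.
Qed.

(* Cauchy-Schwarz for the form (v, w) |-> inner (T v) w. *)
Lemma norm_positive_op_le (T : H -> H) (c : R[i]) : linear T ->
  (forall v, 0 <= inner (T v) v <= c * `|v| ^+ 2) ->
  (forall v w, inner (T v) w = (inner (T w) v)^*) -> 0 <= c ->
  forall v, `|T v| <= c * `|v|.
Proof.
move=> Tl T0 Ts c0 v.
have [->|Tv0] := eqVneq (T v) 0; first by rewrite normr0 mulr_ge0.
have n0 : 0 < `|T v| by rewrite normr_gt0.
(* The bound is squared and multiplied by [|T v|^2]; Cauchy-Schwarz is then used at [v] and [T v],
   where the form takes the value [|T v|^2]. *)
rewrite -(@ler_pXn2r _ 2)// ?nnegrE ?mulr_ge0//.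
rewrite -(ler_pM2r (exprn_gt0 2 n0)).
have Bl y : scalar ((fun v w => inner (T v) w)^~ y).
  by move=> k a b /=; rewrite Tl innerDl innerZl.
have B0 x : 0 <= inner (T x) x by case/andP: (T0 x).
apply: le_trans (_ : inner (T v) v * inner (T (T v)) (T v) <= _).
  have := cauchy_schwarz Bl (fun x y => Ts y x) B0 v (T v).
  by rewrite inner_norm normrX normr_id -exprD -exprM.
have -> : (c * `|v|) ^+ 2 * `|T v| ^+ 2 = c * `|v| ^+ 2 * (c * `|T v| ^+ 2) by ring.
by apply: ler_pM => //; [case/andP: (T0 v)|case/andP: (T0 (T v))].
Qed.

End hilbert.

(* A possibly degenerate *-representation; boundedness is automatic. *)
Record star_rep (R : realType) (A : cstarAlgType R) (H : hilbertType R)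
    (pi : A -> H -> H) : Prop := StarRep {
  rep_linear : forall v, linear (pi^~ v) ;
  rep_op_linear : forall a, linear (pi a) ;
  rep_mul : forall a b v, pi (a * b) v = pi a (pi b v) ;
  rep_star : forall a v w, inner (pi (star a) v) w = inner v (pi a w)
}.

(** * Representations: contractivity and detection of positivity *)

Section star_rep.
Context (R : realType) (A : cstarAlgType R) (H : hilbertType R).
Context (pi : A -> H -> H) (pi_rep : star_rep pi).
Implicit Types (a b h : A) (v w : H).

Lemma repB a b v : pi (a - b) v = pi a v - pi b v.
Proof. by rewrite addrC -scaleN1r rep_linear// scaleN1r addrC. Qed.

Lemma rep0 v : pi 0 v = 0.
Proof. by rewrite -(subrr (0 : A)) repB subrr. Qed.

Lemma repZ k a v : pi (k *: a) v = k *: pi a v.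
Proof. by rewrite -[k *: a]addr0 rep_linear// rep0 addr0. Qed.

Lemma rep_sum n (a : nat -> A) v :
  pi (\sum_(0 <= j < n) a j) v = \sum_(0 <= j < n) pi (a j) v.
Proof.
elim: n => [|n ih]; first by rewrite !big_geq// rep0.
rewrite !big_nat_recr//= -ih.
by have := rep_linear pi_rep v 1 (\sum_(0 <= j < n) a j) (a n); rewrite !scale1r.
Qed.

Lemma rep_inner_star a v : inner (pi (star a * a) v) v = `|pi a v| ^+ 2.
Proof. by rewrite rep_mul// rep_star// inner_norm. Qed.

Lemma rep_inner_conj h v w : self_adjoint h ->
  inner (pi h v) w = (inner (pi h w) v)^*.
Proof. by move=> hs; rewrite -{1}hs rep_star// inner_conj. Qed.

(** Writing [1 - star a * a / |a|^2] as [star s * s] and applying [pi] bounds [|pi a v|^2] by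
    [|a|^2] times the quadratic form of [pi 1]. *)
Lemma rep_contractive a v : `|pi a v| <= `|a| * `|v|.
Proof.
(* [pi 1] may be a proper projection, so its quadratic form has to be bounded separately. *)
have p1 : inner (pi 1 v) v <= `|v| ^+ 2.
  have := rep_inner_star 1 v; rewrite star1 mulr1 => e.
  have le : `|pi 1 v| <= `|v|.
    have [->|n0] := eqVneq (pi 1 v) 0; first by rewrite normr0.
    rewrite -(ler_pM2l (_ : 0 < `|pi 1 v|)) ?normr_gt0// -expr2 -e.
    by rewrite -[leLHS]ger0_norm ?e ?exprn_ge0// -e norm_inner_le.
  by rewrite e ler_pXn2r// nnegrE.
have [->|a0] := eqVneq a 0; first by rewrite rep0 !normr0 mul0r.
have n0 : `|a| ^+ 2 != 0 by rewrite sqrf_eq0 normr_eq0.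
have [||s [ss sE _ _]] := @cstar_sqrt _ _ (`|a| ^- 2 *: (star a * a)).
- by rewrite /self_adjoint starZ star_mul starK (CrealP _)// rpredV rpredX ?normr_real.
- by rewrite normrZ norm_starM normfV ger0_norm ?exprn_ge0// mulVf.
have := rep_inner_star s v; rewrite ss sE repB innerBl repZ innerZl rep_inner_star => e.
have : 0 <= inner (pi 1 v) v - `|a| ^- 2 * `|pi a v| ^+ 2 by rewrite e exprn_ge0.
rewrite subr_ge0 => /le_trans /(_ p1).
rewrite ler_pdivrMl ?exprn_gt0 ?normr_gt0// -exprMn ler_pXn2r ?nnegrE ?mulr_ge0//.
Qed.

Hypothesis pi_faithful : forall a, (forall v, pi a v = 0) -> a = 0.

(** For [g = h / |h|], the element [n g n = - star (q n) (q n)] has a quadratic form of both signs,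
    so [pi (q n) = 0]. Faithfulness gives [q n = 0], and then [g = star q * q]. *)
Lemma rep_positive h : self_adjoint h ->
  (forall v, 0 <= inner (pi h v) v) -> positive h.
Proof.
move=> hs h0; have [->|hn0] := eqVneq h 0; first by exists 0; rewrite mulr0.
have n0 : `|h| != 0 by rewrite normr_eq0.
pose g := `|h|^-1 *: h.
have gs : self_adjoint g by rewrite /self_adjoint starZ hs (CrealP _)// rpredV normr_real.
have g1 : `|g| <= 1 by rewrite normrZ normfV normr_id mulVf.
suff [c gE] : positive g.
  have -> : h = `|h| *: g by rewrite scalerA mulfV// scale1r.
  by apply: positiveZ => //; exists c.
have [q [n [qs ns nhn qn]]] := sa_neg_part gs g1.
exists q; apply/qn/pi_faithful => v.
have : 0 <= inner (pi (n * g * n) v) v.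
  rewrite !rep_mul// -{1}ns rep_star// repZ innerZl mulr_ge0// invr_ge0//.
rewrite nhn -sub0r repB rep0 sub0r -scaleN1r innerZl rep_inner_star mulN1r oppr_ge0.
move=> le0; apply/eqP; rewrite -normr_eq0 -sqrf_eq0 eq_le le0 exprn_ge0//.
Qed.

Lemma rep_ge0 a v : positive a -> 0 <= inner (pi a v) v.
Proof. by case=> b ->; rewrite rep_inner_star exprn_ge0. Qed.

End star_rep.

(** * Complex scalars and limits along ultrafilters *)

Local Notation Re := complex.Re.
Local Notation Im := complex.Im.

(** Compactness of [[-c, c]] gives a cluster point, and a cluster point of an ultrafilter is a
    limit. *)
Lemma ultra_bounded_cvg (R : realType) (T : Type) (G : set_system T) (u : T -> R) (c : R) :
  UltraFilter G -> (forall t, `|u t| <= c) -> cvg (u @ G).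
Proof.
move=> GU uc.
have [p [_ p_cl]] : `[- c, c]%classic `&` cluster (u @ G) !=set0.
  apply: segment_compact.
  by apply: (@filterE _ G) => t; rewrite /= in_itv/= -ler_norml.
apply/cvg_ex; exists p => U pU.
have [//|GnU] := in_ultra_setVsetC (u @^-1` U) GU.
by have [x [/= nUx Ux]] := p_cl _ _ (GnU : (u @ G) (~` U)) pU.
Qed.

Lemma complex_ReIm_eq (R : realType) (z w : R[i]) : Re z = Re w -> Im z = Im w -> z = w.
Proof. by case: z w => [a b] [c d] /= -> ->. Qed.

Lemma ReZ (R : realType) (k : R) (z : R[i]) : Re (k%:C%C * z) = k * Re z.
Proof. by case: z => a b /=; rewrite mul0r subr0. Qed.

Lemma Re_conj (R : realType) (z : R[i]) : Re z^* = Re z.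
Proof. by case: z. Qed.

Lemma norm_Re_le (R : realType) (z : R[i]) : `|Re z| <= Re `|z|.
Proof. by rewrite -lecR [leRHS]RRe_real ?normr_real// normc_ge_Re. Qed.

(** * States and their cluster points *)

Section states.
Context (R : realType) (A : cstarAlgType R).
Implicit Types (phi psi : sa_dual A) (a b : A).

Lemma sa_dual_linear phi k a b : phi (k *: a + b) = k * phi a + phi b.
Proof. by have [+ _ _] := sa_dualP phi; exact. Qed.

Lemma sa_dual0 phi : phi 0 = 0.
Proof. by have := sa_dual_linear phi (-1) 0 0; rewrite scaler0 addr0 mulN1r addNr. Qed.

Lemma sa_dualZ phi k a : phi (k *: a) = k * phi a.
Proof. by have := sa_dual_linear phi k a 0; rewrite !addr0 sa_dual0 addr0. Qed.

Lemma sa_dualD phi a b : phi (a + b) = phi a + phi b.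
Proof. by have := sa_dual_linear phi 1 a b; rewrite scale1r mul1r. Qed.

Lemma sa_dualB phi a b : phi (a - b) = phi a - phi b.
Proof. by rewrite sa_dualD -scaleN1r sa_dualZ mulN1r. Qed.

Lemma sa_dualN phi a : phi (- a) = - phi a.
Proof. by rewrite -sub0r sa_dualB sa_dual0 sub0r. Qed.

Lemma sa_dual_sum phi n (a : nat -> A) :
  phi (\sum_(0 <= j < n) a j) = \sum_(0 <= j < n) phi (a j).
Proof.
elim: n => [|n ih]; first by rewrite !big_geq// sa_dual0.
by rewrite !big_nat_recr//= sa_dualD ih.
Qed.

Lemma sa_dual_star phi a : phi (star a) = (phi a)^*.
Proof. by have [_ _ +] := sa_dualP phi; exact. Qed.

Lemma state_le phi a (c : R[i]) : is_state phi -> positive (c%:A - a) -> phi a <= c.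
Proof.
by move=> [phi0 phi1] /phi0; rewrite sa_dualB sa_dualZ phi1 mulr1 subr_ge0.
Qed.

(** Cauchy-Schwarz against the unit: [|phi a|^2 <= phi (star a * a) <= |star a * a| = |a|^2]. *)
Lemma norm_state_le phi a : is_state phi -> `|phi a| <= `|a|.
Proof.
move=> phiS; have [phi0 phi1] := phiS.
rewrite -(@ler_pXn2r _ 2)// ?nnegrE//.
have Bl y : scalar ((fun x y => phi (star y * x))^~ y).
  by move=> k u v /=; rewrite mulrDr -scalerAr sa_dual_linear.
have Bc x y : phi (star x * y) = (phi (star y * x))^*.
  by rewrite -sa_dual_star star_mul starK.
have B0 x : 0 <= phi (star x * x) by apply: phi0; exists x.
have := cauchy_schwarz Bl Bc B0 a 1.
rewrite star1 !mul1r phi1 mulr1 => /le_trans; apply.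
rewrite -norm_starM; apply: state_le => //; apply: norm_sub_positive.
by rewrite /self_adjoint star_mul starK.
Qed.

(** Positive elements span the algebra, by [cartesian] and [sa_sub_sqr]. *)
Lemma state_ext phi psi : (forall a, positive a -> phi a = psi a) -> phi = psi.
Proof.
move=> h; apply: sa_dual_eq => a.
have sa x : self_adjoint x -> phi x = psi x.
  by move=> /sa_sub_sqr[y [z [yp zp ->]]]; rewrite !sa_dualB !h.
have [x [y [xs ys ->]]] := cartesian a.
by rewrite !sa_dualD !sa_dualZ !sa.
Qed.

(** Weak* compactness of the state space in the form used later: [psi] is the limit along an
    ultrafilter finer than [\oo], so eventual lower bounds survive. *)
Lemma state_cluster (omega : nat -> sa_dual A) : (forall n, is_state (omega n)) ->
  exists psi, is_state psi /\ forall a (c : R),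
    (\forall n \near \oo, c <= Re (omega n a)) -> c <= Re (psi a).
Proof.
move=> omegaS; have [G [GU oG]] := @ultraFilterLemma nat \oo _.
have bnd a n : `|Re (omega n a)| <= Re `|a|.
  apply: (le_trans (norm_Re_le _)).
  by have := norm_state_le a (omegaS n); rewrite lecE => /andP[].
(* Only real parts are passed to the limit; they determine a complex-linear functional. *)
pose L a := lim (Re (omega n a) @[n --> G]).
have Lc a : Re (omega n a) @[n --> G] --> L a.
  exact: ultra_bounded_cvg GU (bnd a).
have LP (k : R) a b : L (k%:C%C *: a + b) = k * L a + L b.
  apply: cvg_lim => //.
  under eq_fun do rewrite sa_dual_linear raddfD/= ReZ.
  by apply: cvgD; [apply: cvgM; [exact: cvg_cst|exact: Lc]|exact: Lc].
have LD a b : L (a + b) = L a + L b by rewrite -[a]scale1r (LP 1) mul1r scale1r.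
have LZ (k : R) a : L (k%:C%C *: a) = k * L a.
  rewrite -[_ *: a]addr0 LP; have := LP (-1) 0 0.
  by rewrite scaler0 addr0 mulN1r addNr => ->; rewrite addr0.
have L_ge a c : (\forall n \near \oo, c <= Re (omega n a)) -> c <= L a.
  move=> h; apply: limr_ge; first by apply/cvg_ex; exists (L a); exact: Lc.
  exact: oG.
have LN a : L (- a) = - L a.
  by apply: (addrI (L a)); rewrite -LD !subrr; have := LZ 0 0; rewrite mul0r scaler0.
have L_const a c : (forall n, Re (omega n a) = c) -> L a = c.
  move=> ac; apply/eqP; rewrite eq_le; apply/andP; split; last first.
    by apply: L_ge; near=> n; rewrite ac.
  by rewrite -lerN2 -LN; apply: L_ge; near=> n; rewrite sa_dualN raddfN/= ac.
have L_star a : L (star a) = L a.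
  apply: cvg_lim => //; under eq_fun do rewrite sa_dual_star Re_conj.
  exact: Lc.
have L_bnd a : `|L a| <= Re `|a|.
  rewrite ler_norml; apply/andP; split.
    by apply: L_ge; near=> n; have := bnd a n; rewrite ler_norml => /andP[].
  rewrite -lerN2 -LN; apply: L_ge; near=> n; rewrite sa_dualN raddfN/= lerN2.
  by have := bnd a n; rewrite ler_norml => /andP[].
have Lk (k : R[i]) a : L (k *: a) = Re k * L a - Im k * L (- 'i *: a).
  rewrite {1}[k]complexE complexiE ['i * _]mulrC scalerDl LD LZ -scalerA LZ.
  by rewrite scaleNr LN mulrN opprK.
(* The imaginary part is recovered from [Im z = Re (- i z)]. *)
pose psi a := (L a +i* L (- 'i *: a))%C.
have psiP : sa_functional psi.
  split.
  - move=> k a b; apply: complex_ReIm_eq.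
      by rewrite raddfD/= LD Lk; case: k.
    rewrite raddfD/= scalerDr LD [_ *: (k *: a)]scalerA mulrC -scalerA Lk.
    rewrite scalerA mulrNN -expr2 sqrCi scaleN1r LN mulrN opprK.
    by case: k => x y /=; rewrite addrC.
  (* The real and imaginary parts contribute [|a|] each. *)
  - exists 2 => a; rewrite [psi a]complexE complexiE; apply: (le_trans (ler_normD _ _)).
    rewrite normrM normCi mul1r !normc_real mulr_natl mulr2n.
    have -> : `|a| = (Re `|a|)%:C%C by rewrite RRe_real// normr_real.
    apply: lerD; rewrite lecR// (le_trans (L_bnd _))//.
    by rewrite normrZ normrN normCi mul1r.
  - move=> a; apply: complex_ReIm_eq; rewrite /= ?L_star//.
    have -> : - 'i *: star a = star ('i *: a) by rewrite starZ conjCi.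
    by rewrite L_star scaleNr LN opprK.
exists (SaDual (asboolT psiP)); split.
  split=> [a a0|]; last first.
    apply: complex_ReIm_eq => /=; apply: L_const => n.
      by have [_ ->] := omegaS n.
    by have [_ h] := omegaS n; rewrite sa_dualZ h mulr1 -complexiE /= oppr0.
  rewrite lecE/=; apply/andP; split.
    apply/eqP/L_const => n; have [/(_ _ a0) + _] := omegaS n.
    rewrite sa_dualZ lecE => /andP[]; case: (omega n a) => x y /= /eqP -> _.
    by rewrite !(mul0r, mulr0, mulNr, subr0, oppr0).
  by apply: L_ge; near=> n; have [/(_ _ a0)] := omegaS n; rewrite lecE => /andP[].
by move=> a c /L_ge.
Unshelve. all: by end_near. Qed.

End states.

(** * Star homomorphisms and actions of the integers *)

Lemma star_rep_comp (R : realType) (A B : cstarAlgType R) (H : hilbertType R)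
    (pi : B -> H -> H) (f : A -> B) :
  star_rep pi -> star_hom f -> star_rep (fun a => pi (f a)).
Proof.
move=> piP [fl fM fs]; split=> [v k a b|a|a b v|a v w].
- by rewrite fl (rep_linear piP).
- exact: rep_op_linear.
- by rewrite fM rep_mul.
- by rewrite fs rep_star.
Qed.

(** [star_hom] does not ask for unitality; here it comes from surjectivity, as [f 1] is a unit for
    the image. *)
Lemma star_automorphism1 (R : realType) (A : cstarAlgType R) (f : A -> A) :
  star_automorphism f -> f 1 = 1.
Proof.
move=> [[_ fM _] [g _ gK]].
by have := fM (g 1) 1; rewrite mulr1 gK mul1r.
Qed.

Section star_hom.
Context (R : realType) (A B : cstarAlgType R) (f : A -> B) (fP : star_hom f).

Lemma star_homD a b : f (a + b) = f a + f b.
Proof. by have [fl _ _] := fP; have := fl 1 a b; rewrite !scale1r. Qed.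

Lemma star_hom0 : f 0 = 0.
Proof. by apply: (addrI (f 0)); rewrite -star_homD !addr0. Qed.

Lemma star_hom_sum n (a : nat -> A) :
  f (\sum_(0 <= j < n) a j) = \sum_(0 <= j < n) f (a j).
Proof.
elim: n => [|n ih]; first by rewrite !big_geq// star_hom0.
by rewrite !big_nat_recr//= star_homD ih.
Qed.

Lemma star_hom_sa a : self_adjoint a -> self_adjoint (f a).
Proof. by have [_ _ fs] := fP; rewrite /self_adjoint -fs => ->. Qed.

Lemma star_hom_positive a : positive a -> positive (f a).
Proof. by have [_ fM fs] := fP; case=> b ->; exists (f b); rewrite fM fs. Qed.

End star_hom.

Lemma sa_sum (R : realType) (A : cstarAlgType R) n (a : nat -> A) :
  (forall j, self_adjoint (a j)) -> self_adjoint (\sum_(0 <= j < n) a j).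
Proof. by move=> h; rewrite /self_adjoint raddf_sum; apply: eq_bigr => j _; exact: h. Qed.

Section Z_action.
Context (R : realType) (A : cstarAlgType R) (Theta : int -> A -> A).
Hypothesis ThetaP : is_Z_action Theta.

Lemma Z_actionD i j a : Theta (i + j) a = Theta i (Theta j a).
Proof. by have [_ ->] := ThetaP. Qed.

Lemma Z_action_hom j : star_hom (Theta j).
Proof. by have [/(_ j)[]] := ThetaP. Qed.

(** [Theta 0] is idempotent and injective. *)
Lemma Z_action0 a : Theta 0 a = a.
Proof.
have [/(_ 0)[_ /bij_inj inj] _] := ThetaP.
by apply: inj; rewrite -Z_actionD.
Qed.

Lemma Z_action_invariant (T : Type) (phi : A -> T) :
  (forall a, phi (Theta 1 a) = phi a) -> forall j a, phi (Theta j a) = phi a.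
Proof.
move=> phi1.
have nat_inv (n : nat) a : phi (Theta n%:Z a) = phi a.
  elim: n a => [|n ih] a; first by rewrite Z_action0.
  by rewrite intS Z_actionD phi1.
(* For a negative index, translating forward by [n.+1] returns to [a]. *)
case=> n a; first exact: nat_inv.
by rewrite -(nat_inv n.+1) -Z_actionD NegzE subrr Z_action0.
Qed.

End Z_action.

(** * Von Neumann algebras on a Hilbert space *)

Section von_neumann.
Context (R : realType) (H : hilbertType R) (M : cstarAlgType R).
Context (incl : M -> bounded_op H) (MP : von_neumann_algebra incl).

Lemma vn_star_rep : star_rep (fun x : M => incl x : H -> H).
Proof.
by split; [exact: vn_linear MP|move=> a; exact: op_linear|exact: vn_mul MP|exact: vn_star MP].
Qed.

Lemma vn_eq0 (x : M) : (forall v, incl x v = 0) -> x = 0.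
Proof.
move=> x0; apply/eqP; rewrite -normr_eq0 eq_le normr_ge0 andbT.
by apply: (vn_norm_min MP) => // v; rewrite x0 normr0 mul0r.
Qed.

(** Bounds the norm by the quadratic form, so that vectors nearly attaining the norm can be found
    through the latter. *)
Lemma vn_norm_le_numerical (x : M) (c : R[i]) : self_adjoint x -> 0 <= c ->
  (forall v, 0 <= inner (incl x v) v <= c * `|v| ^+ 2) -> `|x| <= c.
Proof.
move=> xs c0 h; apply: (vn_norm_min MP) => //.
apply: norm_positive_op_le => //; first exact: op_linear.
by move=> v w; exact: rep_inner_conj vn_star_rep _ _ _ xs.
Qed.

Lemma op_coef_continuous (v w : H) :
  continuous (fun T : wot H => inner ((T : bounded_op H) v) w : R[i]^o).
Proof.
pose ev (h : {ptws H * H -> R[i]^o}) : R[i]^o := h (v, w).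
have ev_cont : continuous ev.
  move=> h.
  have [/(_ (fun _ => id) (v, w)) hh _] := @cvg_sup _ _ (fun a => Topological.class
    (initial_topology (fun h : H * H -> R[i]^o => h a))) (nbhs h) h (@nbhs_filter _ h).
  by apply: cvg_trans (@initial_continuous _ _ ev h); apply: cvg_app; exact: hh.
move=> T; apply: (@continuous_comp (wot H) _ _ (@op_coef R H) ev) => //.
  exact: initial_continuous.
exact: ev_cont.
Qed.

(* The operators T with inner (T v) (w - p w) = 0, p = iota 1, are closed in
   the weak operator topology and contain the image of iota, hence 1. *)
Lemma dense_star_hom1 (A : cstarAlgType R) (iota : A -> M) : star_hom iota ->
  range incl `<=` closure (range (incl \o iota) : set (wot H)) -> iota 1 = 1.
Proof.
move=> iotaP dns; have [_ iM iS] := iotaP.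
have MR := vn_star_rep.
have perp v w : inner v (w - incl (iota 1) w) = 0 :> R[i].
  pose Z := [set T : wot H | inner ((T : bounded_op H) v) (w - incl (iota 1) w) = 0 :> R[i]].
  have Zc : closed Z.
    apply: (@closed_comp _ _ (fun T : wot H => inner ((T : bounded_op H) v)
      (w - incl (iota 1) w) : R[i]^o) [set 0]).
      by move=> T _; exact: op_coef_continuous.
    exact/accessible_closed_set1/hausdorff_accessible/norm_hausdorff.
  have sub : closure (range (incl \o iota) : set (wot H)) `<=` Z.
    rewrite closure_id in Zc; rewrite Zc; apply: closure_subset => _ [a _ <-] /=.
    rewrite /Z/= innerBr -[inner _ (incl (iota 1) w)](rep_star MR).
    by rewrite -iS star1 -(rep_mul MR) -iM mul1r subrr.
  have /sub : closure (range (incl \o iota) : set (wot H)) (incl 1) by apply: dns; exists 1.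
  by rewrite /Z/= (vn_one MP).
apply/esym/eqP; rewrite -subr_eq0; apply/eqP/vn_eq0 => w.
rewrite (repB MR) (vn_one MP); apply/eqP; rewrite -normr_eq0 -sqrf_eq0 -inner_norm.
by rewrite perp.
Qed.

End von_neumann.

(** * Averaged vector states *)

Section averages.
Context (R : realType) (A : cstarAlgType R) (Theta : int -> A -> A).
Hypothesis ThetaP : is_Z_action Theta.
Context (H : hilbertType R) (pi : A -> H -> H).
Hypothesis piP : star_rep pi.
Hypothesis pi1 : forall v, pi 1 v = v.

Lemma average_state (k : nat) (v : H) : (0 < k)%N -> `|v| = 1 ->
  exists phi : sa_dual A, is_state phi /\
    forall a, phi a = k%:R^-1 * \sum_(0 <= j < k) inner (pi (Theta j%:Z a) v) v.
Proof.
move=> k0 v1; have k0' : 0 < k%:R :> R[i] by rewrite ltr0n.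
have ThP (j : nat) := Z_action_hom ThetaP j%:Z.
have rP (j : nat) := star_rep_comp piP (ThP j).
pose f a : R[i] := k%:R^-1 * \sum_(0 <= j < k) inner (pi (Theta j%:Z a) v) v.
have fP : sa_functional f.
  split.
  - move=> c a b; rewrite /f mulrCA -mulrDr; congr (_ * _).
    rewrite mulr_sumr -big_split; apply: eq_bigr => j _ /=.
    by rewrite (rep_linear (rP j)) innerDl innerZl.
  - exists 1 => a; rewrite mul1r normrM ger0_norm ?invr_ge0 ?ler0n// ler_pdivrMl//.
    apply: (le_trans (ler_norm_sum _ _ _)).
    apply: (@le_trans _ _ (\sum_(0 <= j < k) `|a|)).
      apply: ler_sum => j _; apply: (le_trans (norm_inner_le _ _)).
      by rewrite v1 mulr1 (le_trans (rep_contractive (rP j) _ _))// v1 mulr1.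
    by rewrite sumr_const_nat subn0 mulr_natl.
  - move=> a; rewrite /f rmorphM/= fmorphV rmorph_nat rmorph_sum; congr (_ * _).
    by apply: eq_bigr => j _ /=; rewrite (rep_star (rP j)) inner_conj.
exists (SaDual (asboolT fP)); split=> //; split=> [a [b ->]|] /=.
  rewrite /f mulr_ge0 ?invr_ge0 ?ler0n//; apply: sumr_ge0 => j _.
  by rewrite (rep_inner_star (rP j)) exprn_ge0.
rewrite /f (eq_bigr (fun=> 1)).
  by rewrite sumr_const_nat subn0 mulVf// lt0r_neq0.
move=> j _; rewrite star_automorphism1 ?pi1 ?inner_norm ?v1 ?expr1n//.
by have [+ _] := ThetaP; exact.
Qed.

(** The difference telescopes to two boundary terms, each at most [|a|]. *)
Lemma average_almost_invariant (k : nat) (v : H) a : `|v| = 1 ->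
  `|k%:R^-1 * \sum_(0 <= j < k) inner (pi (Theta j%:Z (Theta 1 a)) v) v -
    k%:R^-1 * \sum_(0 <= j < k) inner (pi (Theta j%:Z a) v) v|
  <= k%:R^-1 * (`|a| + `|a|).
Proof.
move=> v1; rewrite -mulrBr -sumrB.
rewrite (eq_bigr (fun j => inner (pi (Theta j.+1%:Z a) v) v
  - inner (pi (Theta j%:Z a) v) v)); last first.
  move=> j _; have -> : j.+1%:Z = j%:Z + 1 by rewrite intS addrC.
  by rewrite Z_actionD.
rewrite telescope_sumr// normrM ger0_norm ?invr_ge0 ?ler0n//.
apply: ler_wpM2l; first by rewrite invr_ge0 ler0n.
have bnd (j : nat) : `|inner (pi (Theta j%:Z a) v) v| <= `|a|.
  have rP := star_rep_comp piP (Z_action_hom ThetaP j%:Z).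
  apply: (le_trans (norm_inner_le _ _)); rewrite v1 mulr1.
  by rewrite (le_trans (rep_contractive rP _ _))// v1 mulr1.
by apply: (le_trans (ler_normB _ _)); apply: lerD.
Qed.

End averages.

(** A Krylov-Bogolyubov argument: the invariance defect tends to 0, so a cluster state is invariant
    under [Theta 1], hence under the whole action. *)
Lemma almost_invariant_cluster (R : realType) (A : cstarAlgType R)
    (Theta : int -> A -> A) (omega : nat -> sa_dual A) (a : A) (c : R) :
  is_Z_action Theta -> (forall n, is_state (omega n)) ->
  (forall n b, `|omega n (Theta 1 b) - omega n b| <= n.+1%:R^-1 * (`|b| + `|b|)) ->
  (forall n, c <= Re (omega n a)) ->
  exists2 psi, invariant_states Theta psi & c <= Re (psi a).
Proof.
move=> ThetaP omegaS omegaI omega_ge.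
have [psi [psiS psi_ge]] := state_cluster omegaS.
exists psi; last by apply: psi_ge; exact: nearW.
split=> //; apply: (Z_action_invariant ThetaP) => b.
have [Tl _ _] := Z_action_hom ThetaP 1.
(* [state_cluster] transfers lower bounds only; equality will follow by using [x] and [- x]. *)
have Re_ge x : 0 <= Re (psi (Theta 1 x - x)).
  rewrite -oppr_le0; apply/ler_addgt0Pr => d d0; rewrite add0r -lerN2 opprK.
  apply: psi_ge; near=> n.
  suff : `|Re (omega n (Theta 1 x - x))| <= d by rewrite ler_norml => /andP[].
  apply: (le_trans (norm_Re_le _)); rewrite sa_dualB.
  rewrite -lecR RRe_real ?normr_real//; apply: (le_trans (omegaI n x)).
  have -> : `|x| = (Re `|x|)%:C%C by rewrite RRe_real ?normr_real.
  rewrite -rmorphD -(rmorph_nat (real_complex R)) -fmorphV -rmorphM/= lecR.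
  rewrite ler_pdivrMl ?ltr0n// -ler_pdivrMr//.
  apply: (@le_trans _ _ n%:R); last by rewrite ler_nat.
  by near: n; exact: nbhs_infty_ger.
have ThetaZ k x : Theta 1 (k *: x) = k *: Theta 1 x.
  by have := Tl k x 0; rewrite (star_hom0 (Z_action_hom ThetaP 1)) !addr0.
have Re0 x : Re (psi (Theta 1 x - x)) = 0.
  apply/eqP; rewrite eq_le Re_ge andbT -oppr_ge0 -raddfN -sa_dualN.
  have -> : - (Theta 1 x - x) = Theta 1 (- x) - (- x).
    by rewrite -(scaleN1r x) ThetaZ !scaleN1r opprK opprB addrC.
  exact: Re_ge.
apply/eqP; rewrite -subr_eq0 -sa_dualB; apply/eqP/complex_ReIm_eq; first exact: Re0.
(* Multiplication by [- i] moves the imaginary part into the real part. *)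
have := Re0 (- 'i *: b); rewrite ThetaZ -scalerBr sa_dualZ -complexiE.
case: (psi _) => x y /=.
by rewrite !(mul0r, mulr0, mulNr, subr0, oppr0, opprK, sub0r, mul1r, oppr_eq0).
Unshelve. all: by end_near. Qed.

Lemma dvg_limn0 (R : realType) (u : nat -> R[i]^o) : ~ cvgn u -> limn u = 0.
Proof. by move=> /dvgP ->. Qed.

(** * Invariant states and the gauge on a faithful C*-model *)

Section model.
Context (R : realType) (H : hilbertType R) (M : cstarAlgType R).
Context (incl : M -> bounded_op H) (rho : sa_dual M) (Xi : int -> M -> M).
Context (A : cstarAlgType R) (Theta : int -> A -> A) (iota : A -> M).
Hypothesis wsP : wstar_system incl rho Xi.
Hypothesis cmP : cstar_model incl Xi Theta iota.
Hypothesis iota_inj : injective iota.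
Implicit Types (a b : A) (v : H).

Let MR := vn_star_rep (ws_algebra wsP).
Let iotaP := cm_hom cmP.
Let ThetaP := cm_action cmP.
Let piR := star_rep_comp MR iotaP.

Lemma model1 : iota 1 = 1.
Proof. exact (dense_star_hom1 (ws_algebra wsP) iotaP (cm_dense cmP)). Qed.

Lemma model_equivariant j a : Xi j (iota a) = iota (Theta j a).
Proof. exact: (congr1 (@^~ a) (cm_equivariant cmP j)). Qed.

Lemma model_faithful a : (forall v, incl (iota a) v = 0) -> a = 0.
Proof.
move=> h; apply: iota_inj; rewrite (star_hom0 iotaP).
exact: (vn_eq0 (ws_algebra wsP)) h.
Qed.

Lemma model_norm_le a : `|iota a| <= `|a|.
Proof. by apply: (vn_norm_min (ws_algebra wsP)) => // v; exact: rep_contractive piR _ _. Qed.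

Lemma model_sum_Xi n a : \sum_(0 <= j < n) Xi j%:Z (iota a) =
  iota (\sum_(0 <= j < n) Theta j%:Z a).
Proof.
by rewrite (star_hom_sum iotaP); apply: eq_bigr => j _; rewrite model_equivariant.
Qed.

(* Injectivity of iota makes it reflect positivity, so that the norm of M
   controls the states of A. *)
Lemma state_le_model_norm phi a : is_state phi -> self_adjoint a -> phi a <= `|iota a|.
Proof.
move=> phiS as_; apply: state_le => //; apply: (rep_positive piR model_faithful).
  by rewrite /self_adjoint raddfB/= starZ star1 as_ (CrealP _)// normr_real.
move=> v; rewrite (repB piR) (repZ piR) model1 (vn_one (ws_algebra wsP)).
rewrite innerBl innerZl inner_norm subr_ge0.
apply: (@le_trans _ _ `|inner (incl (iota a) v) v|).
  apply/real_ler_norm/CrealP.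
  by rewrite -(rep_inner_conj MR)//; exact: star_hom_sa.
apply: (le_trans (norm_inner_le _ _)); rewrite expr2 mulrA ler_wpM2r//.
exact: vn_norm_le (ws_algebra wsP) _ _.
Qed.

(** Weak operator density makes [iota] unital, so the restriction of [rho] is normalised;
    injectivity of [iota] carries faithfulness over. *)
Lemma model_state : exists phi0 : sa_dual A,
  [/\ invariant_states Theta phi0, faithful_state phi0 & forall a, phi0 a = rho (iota a)].
Proof.
have [rho0 rho1] := ws_state wsP; have [il iM iS] := iotaP.
have fP : sa_functional (fun a => rho (iota a)).
  split=> [k a b||a].
  - by rewrite il sa_dual_linear.
  - exists 1 => a; rewrite mul1r.
    exact: le_trans (norm_state_le _ (ws_state wsP)) (model_norm_le a).
  - by rewrite iS sa_dual_star.
exists (SaDual (asboolT fP)); split=> //=.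
- split; last by move=> j a /=; rewrite -model_equivariant (ws_invariant wsP).
  split=> /=; last by rewrite model1.
  by move=> a a0; apply/rho0/star_hom_positive.
- move=> a /=; rewrite iM iS => /(ws_faithful wsP) a0.
  by apply: iota_inj; rewrite a0 (star_hom0 iotaP).
Qed.

(** By invariance [k phi(a)] is the value of [phi] at the orbit sum, which [state_le_model_norm]
    bounds. *)
Lemma invariant_state_le_average phi a k : invariant_states Theta phi ->
  self_adjoint a -> (0 < k)%N ->
  phi a <= k%:R^-1 * `|\sum_(0 <= j < k) Xi j%:Z (iota a)|.
Proof.
move=> [phiS phiI] as_ k0; rewrite model_sum_Xi ler_pdivlMl ?ltr0n//.
have -> : k%:R * phi a = phi (\sum_(0 <= j < k) Theta j%:Z a).
  rewrite sa_dual_sum (eq_bigr (fun=> phi a)) => [|j _]; last exact: phiI.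
  by rewrite sumr_const_nat subn0 mulr_natl.
apply: state_le_model_norm => //; apply: sa_sum => j.
exact: (star_hom_sa (Z_action_hom ThetaP _)).
Qed.

Lemma gauge_converges a : positive a -> gauge Xi (iota a) = rho (iota a) ->
  (fun k : nat => k%:R^-1 * `|\sum_(0 <= j < k) Xi j%:Z (iota a)| : R[i]^o)
    @ \oo --> (rho (iota a) : R[i]^o).
Proof.
move=> a0 ga; rewrite -ga /gauge.
set g := (X in limn X).
have [//|ng] := pselect (cvgn g).
(* A divergent sequence has the junk limit 0, which forces a = 0 by
   faithfulness of rho. *)
have /esym := ga; rewrite /gauge -/g dvg_limn0// => ra0.
have [b ab] := a0; have [_ iM iS] := iotaP.
have b0 : b = 0.
  apply: iota_inj; rewrite (star_hom0 iotaP); apply: (ws_faithful wsP).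
  by rewrite -iS -iM -ab.
suff -> : g = (fun=> 0) by exact: cvg_cst.
apply/funext => k; rewrite /g model_sum_Xi ab b0 mulr0 big1 => [|j _].
  by rewrite (star_hom0 iotaP) normr0 mulr0.
exact: star_hom0 (Z_action_hom ThetaP _).
Qed.

Lemma gauge_uniquely_ergodic :
  (forall a, positive a -> gauge Xi (iota a) = rho (iota a)) -> uniquely_ergodic Theta.
Proof.
move=> gaugeE; have [phi0 [phi0I _ phi0E]] := model_state.
exists phi0; apply/seteqP; split=> [phi phiI|_ -> //].
have le a : positive a -> phi a <= rho (iota a).
  move=> a0; have gc := gauge_converges a0 (gaugeE _ a0).
  have [[phi_ge _] _] := phiI; have [[phi0_ge _] _] := phi0I.
  have pr : phi a \is Num.real by rewrite ger0_real// phi_ge.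
  have rr : rho (iota a) \is Num.real by rewrite -phi0E ger0_real// phi0_ge.
  (* The order on [R[i]] is partial; arguing by contradiction is possible because both sides are
     real. *)
  rewrite real_leNgt//; apply/negP => lt.
  have e0 : 0 < phi a - rho (iota a) by rewrite subr_gt0.
  (* The index [N.+1] is positive, as the bound by averages demands; the average there would lie
     below [phi a]. *)
  have /cvgrPdist_lt/(_ _ e0)[N _ /(_ N.+1 (leqnSn N))] := gc.
  have le := invariant_state_le_average phiI (positive_sa a0) (ltn0Sn N).
  rewrite /= distrC ger0_norm ?subr_ge0 ?(le_trans (ltW lt))//.
  by rewrite ltrD2r => /(le_lt_trans le); rewrite ltxx.
apply: state_ext => a a0; rewrite phi0E; apply/eqP; rewrite eq_le le//=.
(* Both states are 1 at the unit, so the inequality at [|a| 1 - a] is the reverse one at [a]. *)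
have := le _ (norm_sub_positive (positive_sa a0)).
have [[_ phi1] _] := phiI; have [[_ phi01] _] := phi0I.
by rewrite -!phi0E !sa_dualB !sa_dualZ phi1 phi01 lerD2l lerN2.
Qed.

(** Contrapositive of [vn_norm_le_numerical], followed by normalising the vector. *)
Lemma exists_unit_vector (x : M) (c : R[i]) : self_adjoint x -> 0 <= c ->
  (forall v, 0 <= inner (incl x v) v) -> c < `|x| ->
  exists2 v, `|v| = 1 & c <= inner (incl x v) v.
Proof.
move=> xs c0 x0 cx.
have [v nv] : exists v, ~~ (inner (incl x v) v <= c * `|v| ^+ 2).
  apply: contrapT => nex; have : `|x| <= c.
    apply: (vn_norm_le_numerical (ws_algebra wsP)) => // v; rewrite x0/=.
    by apply/negPn/negP => h; apply: nex; exists v.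
  by move=> /(lt_le_trans cx); rewrite ltxx.
have v0 : `|v| != 0.
  apply: contraNneq nv => /eqP; rewrite normr_eq0 => /eqP ->.
  have -> : incl x 0 = 0.
    by have := op_linear (incl x) (-1) 0 0; rewrite scaler0 addr0 scaleN1r addNr.
  by rewrite inner0l mulr_ge0// exprn_ge0.
exists (`|v|^-1 *: v); first by rewrite normrZ normfV normr_id mulVf.
have -> : incl x (`|v|^-1 *: v) = `|v|^-1 *: incl x v.
  have := op_linear (incl x) (-1) 0 0; rewrite scaler0 addr0 scaleN1r addNr => x00.
  by have := op_linear (incl x) `|v|^-1 v 0; rewrite x00 !addr0.
rewrite innerZl innerZr (CrealP _) ?rpredV ?normr_real//.
have vp : 0 < `|v| ^+ 2 by rewrite exprn_gt0// lt_neqAle eq_sym v0 /=.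
rewrite mulrA -invfM -expr2 ler_pdivlMl// mulrC.
by apply: ltW; rewrite real_ltNge// ger0_real// mulr_ge0// exprn_ge0.
Qed.

Lemma uniquely_ergodic_gauge a : uniquely_ergodic Theta -> positive a ->
  gauge Xi (iota a) = rho (iota a).
Proof.
move=> [phi uniq] a0; have [phi0 [phi0I _ phi0E]] := model_state.
set l := rho (iota a).
have l0 : 0 <= l by have [[+ _] _] := phi0I; rewrite /l -phi0E; exact.
pose g (k : nat) : R[i]^o := k%:R^-1 * `|\sum_(0 <= j < k) Xi j%:Z (iota a)|.
have g_ge k : (0 < k)%N -> l <= g k.
  by rewrite /l -phi0E; exact: invariant_state_le_average (positive_sa a0).
rewrite /gauge -/g; apply: cvg_lim => //; apply/cvgrPdist_lt => e e0.
apply: contrapT => nnear.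
(* Since [g] stays above [l], failure of convergence means exceeding [l + e] at arbitrarily large
   indices. *)
have freq (n : nat) : exists k, [/\ (n < k)%N & l + e <= g k].
  apply: contrapT => nk; apply: nnear; exists n.+1 => // k /= nk1.
  have lk := g_ge k (leq_ltn_trans (leq0n _) nk1).
  rewrite distrC ger0_norm ?subr_ge0// ltrBlDl.
  rewrite real_ltNge ?ger0_real ?addr_ge0 ?(ltW e0) ?(le_trans l0)//.
  by apply/negP => h; apply: nk; exists k.
(* Halving [e] provides the strict inequality that [exists_unit_vector] requires. *)
have e2 : 0 < e / 2 by rewrite divr_gt0.
have near_state (n : nat) : exists psi : sa_dual A, [/\ is_state psi,
    Re (l + e / 2) <= Re (psi a) &
    forall b, `|psi (Theta 1 b) - psi b| <= n.+1%:R^-1 * (`|b| + `|b|)].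
  have [k [nk lk]] := freq n; have k0 : (0 < k)%N by exact: leq_ltn_trans nk.
  have k0' : 0 < k%:R :> R[i] by rewrite ltr0n.
  pose x := \sum_(0 <= j < k) Theta j%:Z a.
  have ThP j := Z_action_hom ThetaP j.
  have [v v1 lv] : exists2 v, `|v| = 1 & k%:R * (l + e / 2) <= inner (incl (iota x) v) v.
    apply: exists_unit_vector.
    - by apply: (star_hom_sa iotaP); apply: sa_sum => j; apply/(star_hom_sa (ThP _))/positive_sa.
    - by rewrite mulr_ge0// addr_ge0// ltW.
    - move=> v; rewrite (rep_sum piR) inner_suml; apply: sumr_ge0 => j _.
      exact: (rep_ge0 piR v (star_hom_positive (ThP _) a0)).
    - rewrite -model_sum_Xi -ltr_pdivlMl//; apply: lt_le_trans lk.
      by rewrite ltrD2l gtr_pMr// invf_lt1 ?ltr1n.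
  have pi1 w : incl (iota 1) w = w by rewrite model1 (vn_one (ws_algebra wsP)).
  have [psi [psiS psiE]] := average_state ThetaP piR pi1 k0 v1.
  exists psi; split=> //.
    have : l + e / 2 <= psi a.
      by rewrite psiE ler_pdivlMl// -inner_suml -(rep_sum piR).
    by rewrite lecE => /andP[].
  (* [n < k] replaces the factor [1 / k] by [1 / (n + 1)]. *)
  move=> b; rewrite !psiE; apply: (le_trans (average_almost_invariant ThetaP piR _ _ v1)).
  by rewrite ler_wpM2r ?addr_ge0// lef_pV2 ?posrE ?ltr0n// ler_nat.
have [omega omegaP] := choice near_state.
have [|||psi psiI le] := @almost_invariant_cluster _ _ Theta omega a (Re (l + e / 2)) ThetaP.
- by move=> n; have [] := omegaP n.
- by move=> n b; have [_ _ +] := omegaP n; exact.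
- by move=> n; have [_ +] := omegaP n.
(* Uniqueness forces the value [l] on [psi a], against the lower bound [l + e / 2]. *)
have psiE : psi = phi0.
  by move: psiI phi0I; rewrite uniq => -> ->.
move: le; rewrite psiE phi0E -/l raddfD/= gerDl.
by move: e2; rewrite ltcE => /andP[_] /lt_le_trans h /h; rewrite ltxx.
Qed.

End model.

Theorem theorem2p7 (R : realType)
    (H : hilbertType R) (M : cstarAlgType R) (incl : M -> bounded_op H)
    (rho : sa_dual M) (Xi : int -> M -> M)
    (L : hilbertType R) (Lambda : M -> L)
    (A : cstarAlgType R) (Theta : int -> A -> A) (iota : A -> M) :
  wstar_system incl rho Xi ->
  L2_completion rho Lambda -> separable L ->
  cstar_model incl Xi Theta iota -> injective iota -> separable A ->
  [/\ uniquely_ergodic Theta <-> strictly_ergodic Theta,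
      uniquely_ergodic Theta ->
        (forall a : A, positive a -> gauge Xi (iota a) = rho (iota a))
    & is_simplex (invariant_states Theta) ->
        (forall a : A, positive a -> gauge Xi (iota a) = rho (iota a)) ->
        uniquely_ergodic Theta].
Proof.
move=> wsP _ _ cmP iota_inj _; split.
- split=> [[phi uniq]|[phi [uniq _]]]; last by exists phi.
  have [phi0 [phi0I phi0F _]] := model_state wsP cmP iota_inj.
  (* Uniqueness identifies the invariant state with the faithful state [phi0]. *)
  by exists phi0; split=> //; move: phi0I; rewrite uniq => ->.
- by move=> ue a; exact: (uniquely_ergodic_gauge wsP cmP iota_inj).
- by move=> _; exact: (gauge_uniquely_ergodic wsP cmP iota_inj).
Qed.
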